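(* For every fair division instance $(N,M,(v_i)_{i\in N})$ with $n=|N|\ge 1$ agents, a finite set $M$ of indivisible goods, and additive valuations $v_i:2^M\to\mathbb{R}_{\ge 0}$, there exists an allocation $(B_1,\dots,B_n)$ of $M$ such that $v_i(B_i)\ge \tfrac{7}{9}\,\mathsf{MMS}_i$ for every agent $i\in N$; that is, a $\tfrac79$-MMS allocation always exists.
   Context: A valuation $v_i$ is additive if $v_i(S)=\sum_{g\in S}v_i(\{g\})$ for all $S\subseteq M$, with $v_i(\{g\})\ge 0$. An allocation $(B_1,\dots,B_n)$ is a partition of $M$ into $n$ pairwise disjoint (possibly empty) bundles, $B_i$ going to agent $i$. Let $\Pi_n(M)$ denote the set of partitions of $M$ into $n$ bundles. The maximin share of agent $i$ is $\mathsf{MMS}_i=\max_{(P_1,\dots,P_n)\in\Pi_n(M)}\min_{j} v_i(P_j)$. An allocation is $\alpha$-MMS if $v_i(B_i)\ge\alpha\cdot\mathsf{MMS}_i$ for all $i$. *)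

(* Defs.v *)
From HB Require Import structures.
From mathcomp Require Import all_boot all_order all_algebra.
Set Implicit Arguments. Unset Strict Implicit. Unset Printing Implicit Defensive.
Import Order.TTheory GRing.Theory Num.Theory.
Local Open Scope ring_scope.

Definition addval (R : numDomainType) (M : finType) (v : M -> R) (S : {set M}) : R :=
  \sum_(g in S) v g.

(* An n-partition (allocation) of M into k possibly empty bundles is encoded
   as a map P : M -> 'I_k assigning each good to its bundle; bundle j is: *)
Definition bundle (M : finType) (k : nat) (P : {ffun M -> 'I_k}) (j : 'I_k) : {set M} :=
  [set g | P g == j].

(* Maximin share with n.+1 agents (so at least one agent):
   max over all partitions P of min_j v(P_j).  The inner min uses the value of
   the first bundle as neutral element (exact, since it belongs to the range);
   the outer max uses 0 as neutral element, which is exact because all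
   values are nonnegative (so every min_j v(P_j) >= 0). *)
Definition MMS (R : realDomainType) (M : finType) (n : nat) (v : M -> R) : R :=
  \big[Num.max/0]_(P : {ffun M -> 'I_n.+1})
     \big[Num.min/addval v (bundle P ord0)]_(j < n.+1) addval v (bundle P j).

(* Main.v *)
(** Scale every maximin share to 9 and look for bundles worth 7.  By a picking sequence it
    suffices to treat ordered instances, where all agents rank the goods 0, 1, 2, ... alike; pad
    them with worthless goods.
    With n agents left, give [k+1] consecutive goods starting at position [k n], [k <= 3], to
    anyone who values them at 7 or more: by pigeonhole the others keep [n-1] bins worth 9.
    Likewise give the best good with the last good [y] of position at least [2n] that completes
    it to 7.  Another agent may then see a merged bin worth less than 9; but then all its goods
    are worth at most [G], with [20/3 < G < 7], and are either large (more than 2) or dust (less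
    than [7 - G]), and every bin is worth 9 once dust is counted 7/6 times ("dirty" bins).
    When neither applies, split the goods into n tops, n mids and the fills.  Give away any
    top-mid pair worth 7 to someone; then repeatedly take the last top, the last mid and fills,
    the final fill being the last good that brings the bag to 7 for somebody.  Each remaining
    agent keeps a linear or counting inequality between a weight of the goods left and the
    number of agents left, which guarantees that every bag can be filled. *)
Require Import Defs.
From HB Require Import structures.
From mathcomp Require Import all_boot all_order all_algebra.
From mathcomp Require Import zify ring lra.
Import Order.TTheory GRing.Theory Num.Theory.
Set Implicit Arguments. Unset Strict Implicit. Unset Printing Implicit Defensive.
Local Open Scope ring_scope.

(** * Bins and the pigeonhole reductions *)

(** The obstacle is overshoot. Before its last fill a bag is worth less than 7 to everyone else, and
    a fill is worth less than 7/3, so only a last fill above 2 can carry the bag past 9, and then by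
    less than 1/3. Taking the last completing fill turns the accident into information: after an
    overshoot every fill left is either above 2 or too small to complete that bag, hence below 1/3.
    The factor 7/6 has two sides. Merging needs it to be large enough: the bin of the best good,
    worth less than 7, leaves dust worth more than 2, which must make up for a lost partner worth up
    to 7/3, that is 7/6 of 2. The bags need it to be small enough: an agent who finds a bag
    unfillable sees less than 7 per top-mid pair, the fills included, and 7/6 of 7 is still below 9
    - 1/3, where 1/3 is the deficit per agent that [budget] tolerates. *)

Definition bin (f : nat -> nat) (s : seq nat) (j : nat) : seq nat := [seq x <- s | f x == j].

(** Goods with [f x >= n] lie in no bin, so leftovers are allowed and a bin is discarded by giving
    it a label out of range. *)
Definition binned (I : seq nat -> Prop) (s : seq nat) (n : nat) : Prop :=
  exists f : nat -> nat, forall j, (j < n)%N -> I (bin f s j).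

Lemma binned_drop (I : seq nat -> Prop) (s : seq nat) (n X : nat) (f : nat -> nat) :
  (X <= n)%N -> (forall j, (j <= n)%N -> j != X -> I (bin f s j)) -> binned I s n.
Proof.
move=> leXn If.
exists (fun x => if f x == n then X else if f x == X then n else f x) => j ltjn.
pose j' := if j == X then n else j.
have -> : bin (fun x => if f x == n then X else if f x == X then n else f x) s j = bin f s j'.
  apply: eq_filter => x; rewrite /j' /=.
  by case e1: (f x == n); case e2: (f x == X); case e3: (j == X); lia.
by apply: If; rewrite /j'; case: (eqVneq j X) => *; lia.
Qed.

Lemma binned_delete (I : seq nat -> Prop) (s S : seq nat) (n X : nat) (f : nat -> nat) :
  (X <= n)%N -> (forall x, x \in S -> f x = X) ->
  (forall j, (j <= n)%N -> j != X -> I (bin f s j)) ->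
  binned I [seq x <- s | x \notin S] n.
Proof.
move=> leXn SX If; apply: (@binned_drop _ _ _ X f) => // j lejn neq.
have -> : bin f [seq x <- s | x \notin S] j = bin f s j.
  rewrite /bin -filter_predI; apply: eq_filter => x /=.
  case: (boolP (x \in S)) => [/SX ->|]; last by rewrite andbT.
  by rewrite andbF; apply/esym; apply/negbTE; rewrite eq_sym.
exact: If.
Qed.

(* Items are indexed by decreasing value, so the smaller index is the better item. *)
Definition exchangeable (I : seq nat -> Prop) (s : seq nat) : Prop :=
  [/\ forall b b', perm_eq b b' -> I b -> I b',
      forall x y b, x \in s -> y \in s -> (x < y)%N -> I (y :: b) -> I (x :: b)
    & forall x b, x \in s -> I b -> I (x :: b)].

(** Besides [X], only the bin of [y] changes, and there the better good [p] replaces [y]. *)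
Lemma bin_swap (I : seq nat -> Prop) (s : seq nat) (X p y : nat) (f : nat -> nat) (N : nat -> bool) :
  uniq s -> exchangeable I s -> p \in s -> y \in s -> (p < y)%N -> f p = X -> f y != X ->
  (forall j, N j -> j != X -> I (bin f s j)) ->
  let f' z := if z == p then f y else if z == y then X else f z in
  forall j, N j -> j != X -> I (bin f' s j).
Proof.
move=> us [Iperm Irepl _] ps ys ltpy fp fy If f' j Nj jX.
have npy : p == y = false by lia.
case: (eqVneq j (f y)) => [ej|nej]; last first.
  have -> : bin f' s j = bin f s j; last exact: If.
  apply: eq_filter => z; rewrite /f'.
  case: (eqVneq z p) => [->|_]; first by rewrite fp eq_sym (negbTE nej) eq_sym (negbTE jX).
  case: (eqVneq z y) => [->|//]; by rewrite eq_sym (negbTE jX) eq_sym (negbTE nej).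
subst j.
have P1 : perm_eq (bin f s (f y)) (y :: [seq z <- bin f s (f y) | z != y]).
  apply: uniq_perm; rewrite ?filter_uniq //=.
    by rewrite mem_filter eqxx /= !filter_uniq.
  move=> z; rewrite inE !mem_filter; case: (eqVneq z y) => [->|] //=; by rewrite eqxx ys.
have P2 : perm_eq (p :: [seq z <- bin f s (f y) | z != y]) (bin f' s (f y)).
  apply: uniq_perm; rewrite ?filter_uniq //=.
    by rewrite !mem_filter !filter_uniq // andbT fp [X == _]eq_sym (negbTE fy) andbF.
  move=> z; rewrite inE !mem_filter /f'; case: (eqVneq z p) => [->|zp] /=; first by rewrite eqxx ps.
  case: (eqVneq z y) => [->|//] /=; by rewrite eq_sym (negbTE fy).
apply: (Iperm _ _ P2); apply: (Irepl p y) => //.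
by apply: (Iperm _ _ P1); apply: If.
Qed.

(** As long as a good of [S] lies outside bin [X], the count forces a good of [U] into bin [X];
    swapping the two harms no other bin. The induction is on the number of goods of [S] outside
    [X]. *)
Lemma gather (I : seq nat -> Prop) (U S s : seq nat) (X : nat) (N : nat -> bool) (f : nat -> nat) :
  uniq s -> exchangeable I s -> {subset U <= s} -> {subset S <= s} -> uniq (U ++ S) ->
  (forall x y, x \in U -> y \in S -> (x < y)%N) ->
  (size S <= count (fun x => f x == X) (U ++ S))%N ->
  (forall j, N j -> j != X -> I (bin f s j)) ->
  exists f', (forall x, x \in S -> f' x = X) /\ (forall j, N j -> j != X -> I (bin f' s j)).
Proof.
move=> us Is Us Ss; move ek : (count (fun x => f x != X) S) => k.
elim: k f ek => [|k IH] f ek uUS ltUS cnt If.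
  exists f; split=> // x xS; apply/eqP; move/eqP: ek.
  by rewrite -leqn0 leqNgt -has_count => /hasPn /(_ x xS); rewrite negbK.
have /hasP [y yS fy] : has (fun x => f x != X) S by rewrite has_count ek.
have /hasP [p pU /eqP fp] : has (fun x => f x == X) U.
  rewrite has_count; have := count_predC (fun x => f x == X) S.
  have -> : count (predC (fun x => f x == X)) S = k.+1 by rewrite -ek; exact: eq_count.
  by rewrite count_cat in cnt; lia.
have ltpy := ltUS _ _ pU yS.
have uS : uniq S by move: uUS; rewrite cat_uniq => /and3P [].
have uU : uniq U by move: uUS; rewrite cat_uniq => /and3P [].
pose f' z := if z == p then f y else if z == y then X else f z.
have yU : y \notin U by apply/negP => yU; have := ltUS _ _ yU yS; lia.
have pS : p \notin S by apply/negP => pS; have := ltUS _ _ pU pS; lia.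
have cS (a : pred nat) : (count a S = a y + count a (rem y S))%N.
  by rewrite (permP (perm_to_rem yS)) /=.
have cU (a : pred nat) : (count a U = a p + count a (rem p U))%N.
  by rewrite (permP (perm_to_rem pU)) /=.
have eS (a : pred nat) : count (fun x => a (f' x)) (rem y S) = count (fun x => a (f x)) (rem y S).
  apply: eq_in_count => z zr; rewrite /f'; move: zr; rewrite mem_rem_uniq // inE => /andP [zy zS].
  rewrite (negbTE zy); case: eqP => // ezp; by rewrite -ezp zS in pS.
have eU (a : pred nat) : count (fun x => a (f' x)) (rem p U) = count (fun x => a (f x)) (rem p U).
  apply: eq_in_count => z zr; rewrite /f'; move: zr; rewrite mem_rem_uniq // inE => /andP [zp zU].
  rewrite (negbTE zp); case: eqP => // ezy; by rewrite -ezy zU in yU.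
have f'y : f' y = X by rewrite /f' eqxx; case: eqP => //; lia.
have f'p : f' p = f y by rewrite /f' eqxx.
apply: (IH f') => //.
- move: ek; rewrite !cS f'y eqxx fy (eS (fun z => z != X)); lia.
- move: cnt; rewrite !count_cat !cS !cU f'y f'p fp eqxx (negbTE fy).
  rewrite (eS (fun z => z == X)) (eU (fun z => z == X)); lia.
- by apply: (@bin_swap I s X p y f N) => //; [exact: Us | exact: Ss].
Qed.

Lemma pigeonhole_count (s : seq nat) (f : nat -> nat) (n k : nat) :
  (forall x, x \in s -> (f x < n)%N) -> (k * n < size s)%N ->
  exists2 X, (X < n)%N & (k < count (fun x => f x == X) s)%N.
Proof.
move=> fn ks.
have [/existsP [X HX]|/existsPn no] :=
  boolP [exists X : 'I_n, (k < count (fun x => f x == X) s)%N]; first by exists (X : nat).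
have: (\sum_(X < n) count (fun x => f x == X) s <= \sum_(X < n) k)%N.
  by apply: leq_sum => X _; rewrite leqNgt no.
rewrite sum_nat_const card_ord.
suff -> : (\sum_(X < n) count (fun x => f x == X) s)%N = size s by lia.
elim: s fn {ks no} => [|x s IH] fn /=; first by rewrite big1.
rewrite big_split /= IH; last by move=> z zs; apply: fn; rewrite inE zs orbT.
rewrite -add1n; congr (_ + _)%N; have fx : (f x < n)%N by apply: fn; rewrite inE eqxx.
rewrite (bigD1 (Ordinal fx)) //= eqxx big1 ?addn0 // => i ni.
case: eqP => // e; case/eqP: ni; exact: val_inj.
Qed.

Lemma ltn_sorted_cat (s1 s2 : seq nat) : sorted ltn (s1 ++ s2) ->
  forall x y, x \in s1 -> y \in s2 -> (x < y)%N.
Proof.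
rewrite sorted_pairwise ?pairwise_cat; last exact: ltn_trans.
by case/and3P => /allrelP H _ _.
Qed.

(** Leftover goods are thrown into bin 0, which is harmless since enlarging a bin preserves [I].
    Pigeonhole arguments need such a total assignment. *)
Lemma binned_total (I : seq nat -> Prop) (s : seq nat) (n : nat) :
  exchangeable I s -> binned I s n.+1 ->
  exists2 f : nat -> nat, forall x, (f x < n.+1)%N & forall j, (j < n.+1)%N -> I (bin f s j).
Proof.
move=> Is [f If]; case: (Is) => Iperm Irepl Isup.
pose f0 x := if (f x < n.+1)%N then f x else 0%N.
exists f0 => [x|j jn]; first by rewrite /f0; case: ifP.
have := If _ jn.
have G (t u : seq nat) : {subset t <= s} -> I (u ++ bin f t j) -> I (u ++ bin f0 t j).
  elim: t u => [|x t IH] u ts //= H.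
  have ts' : {subset t <= s} by move=> z zt; apply: ts; rewrite inE zt orbT.
  have xs : x \in s by apply: ts; rewrite inE eqxx.
  have rc (a : nat) (b : seq nat) : perm_eq (u ++ a :: b) (rcons u a ++ b).
    by rewrite cat_rcons.
  case e : (f x == j) H => H.
    have -> : f0 x == j by rewrite /f0; move/eqP: e => ->; rewrite jn.
    apply: (Iperm (rcons u x ++ bin f0 t j)); first by rewrite cat_rcons.
    apply: IH => //; by rewrite cat_rcons.
  case: (f0 x == j); last exact: IH.
  apply: (Iperm (x :: (u ++ bin f0 t j))).
    by rewrite -cat1s -[in X in perm_eq _ X]cat1s perm_catCA.
  apply: Isup => //; exact: IH.
exact: (G s [::]).
Qed.

(** The first [k n + k + 1] goods outnumber [k (n + 1)], so some bin holds [k + 1] of them. Trading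
    these for [s2] by [gather] lets the bin disappear together with [s2]. *)
Lemma binned_pigeonhole (I : seq nat -> Prop) (s1 s2 s3 : seq nat) (n k : nat) :
  sorted ltn (s1 ++ s2 ++ s3) -> exchangeable I (s1 ++ s2 ++ s3) ->
  size s1 = (k * n)%N -> size s2 = k.+1 ->
  binned I (s1 ++ s2 ++ s3) n.+1 -> binned I (s1 ++ s3) n.
Proof.
set s := s1 ++ s2 ++ s3 => so Is z1 z2 [f If].
have us : uniq s by apply: sorted_uniq so; [exact: ltn_trans | exact: ltnn].
have [f0 f0n If0] := binned_total Is (ex_intro _ f If).
have lts2 : forall x y, x \in s1 -> y \in s2 -> (x < y)%N.
  by move=> x y x1 y2; apply: (ltn_sorted_cat so) => //; rewrite mem_cat y2.
have us12 : uniq (s1 ++ s2) by move: us; rewrite /s catA cat_uniq => /andP [].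
have [||X Xn cX] := @pigeonhole_count (s1 ++ s2) f0 n.+1 k.
- by move=> x _; exact: f0n.
- by rewrite size_cat z1 z2 mulnS; lia.
have [||||f' [f'S If']] := @gather I s1 s2 s X (fun j => (j < n.+1)%N) f0 us Is _ _ us12 lts2.
- by move=> x xs; rewrite mem_cat xs.
- by move=> x xs; rewrite !mem_cat xs orbT.
- by rewrite z2.
- by move=> j jn _; exact: If0.
have -> : s1 ++ s3 = [seq x <- s | x \notin s2].
  have us' := us; move: us'; rewrite /s cat_uniq cat_uniq => /and4P [u1 h1 u2 /andP [h2 u3]].
  rewrite !filter_cat.
  have -> : [seq x <- s1 | x \notin s2] = s1.
    apply/all_filterP/allP => x xs; apply/negP => x2; have := lts2 _ _ xs x2; lia.
  have -> : [seq x <- s2 | x \notin s2] = [::].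
    apply/eqP; rewrite -size_eq0 size_filter -leqn0 leqNgt -has_count.
    by apply/hasPn => x ->.
  have -> : [seq x <- s3 | x \notin s2] = s3.
    apply/all_filterP/allP => x xs; apply/negP => x2.
    by move/hasPn: h2 => /(_ _ xs); rewrite x2.
  by [].
by apply: (@binned_delete I s s2 n X f').
Qed.

(** If the bin of [g] has a second good before [y], swapping that good with [y] puts the pair into
    one bin. Otherwise the two bins are merged; the last hypothesis covers exactly this case, and
    [I'] may be weaker than [I] because a merged bin may only satisfy less. *)
Lemma binned_pair (I I' : seq nat -> Prop) (g y : nat) (s : seq nat) (n : nat) (f : nat -> nat) :
  uniq (g :: s) -> y \in s -> exchangeable I (g :: s) ->
  (forall b b', perm_eq b b' -> I' b -> I' b') -> (forall b, I b -> I' b) ->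
  (forall x, (f x < n.+1)%N) -> (forall j, (j < n.+1)%N -> I (bin f (g :: s) j)) ->
  (f y != f g -> (forall p, p \in s -> f p = f g -> (y < p)%N) ->
    I' (bin f s (f g) ++ [seq x <- bin f s (f y) | x != y])) ->
  binned I' [seq x <- g :: s | x \notin [:: g; y]] n.
Proof.
move=> us ys Is I'perm II' fn If Hm.
have ngy : (g == y) = false by apply/negbTE/eqP => e; move: us; rewrite e /= ys.
case: (eqVneq (f y) (f g)) => [fyg|nfyg].
  apply: (@binned_delete I' _ _ n (f g) f) => [|x|j lejn _]; first by rewrite -ltnS.
    by rewrite !inE => /orP [] /eqP ->.
  by apply: II'; exact: If.
case: (boolP (has (fun p => (f p == f g) && (p < y)%N) s)) => [/hasP [p ps /andP [/eqP fp ltpy]]|/hasPn no].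
  pose f' z := if z == p then f y else if z == y then f g else f z.
  have If' := @bin_swap I (g :: s) (f g) p y f (fun j => (j < n.+1)%N) us Is.
  apply: (@binned_delete I' _ _ n (f g) f') => [|x|j lejn nj]; first by rewrite -ltnS.
    rewrite !inE /f' => /orP [] /eqP ->; last by rewrite eqxx; case: eqP => //; lia.
    rewrite ngy; case: eqP => // e; by move: us; rewrite e /= ps.
  apply: II'; apply: If' => //; rewrite ?inE ?ps ?ys ?orbT // => j' j'n _; exact: If.
have {}Hm := Hm nfyg.
pose f1 x := if f x == f g then f y else f x.
apply: (@binned_drop I' _ n (f g) f1) => [|j lejn nj]; first by rewrite -ltnS.
have gE : [seq x <- g :: s | x \notin [:: g; y]] = [seq x <- s | x != y].
  rewrite /= inE eqxx /=; apply: eq_in_filter => x xs; rewrite !inE.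
  by case: eqP => // e; move: us; rewrite -e /= xs.
have uns : uniq s by case/andP: us.
have gns : g \notin s by case/andP: us.
rewrite gE; case: (eqVneq j (f y)) => [->|njy]; last first.
  have -> : bin f1 [seq x <- s | x != y] j = bin f (g :: s) j.
    rewrite /bin /= eq_sym (negbTE nj) -filter_predI; apply: eq_in_filter => x xs /=.
    rewrite /f1; case: (eqVneq x y) => [->|_].
      by rewrite andbF [f y == j]eq_sym (negbTE njy).
    rewrite andbT; case: (eqVneq (f x) (f g)) => [->|//].
    by rewrite [f y == j]eq_sym (negbTE njy) [f g == j]eq_sym (negbTE nj).
  by apply: II'; exact: If.
apply: (I'perm (bin f s (f g) ++ [seq x <- bin f s (f y) | x != y])); last first.
  apply: Hm => p ps fp; have := no _ ps; rewrite fp eqxx /= -leqNgt leq_eqVlt => /orP [/eqP e|//].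
  by move: nfyg; rewrite e fp eqxx.
apply: uniq_perm.
- rewrite cat_uniq !filter_uniq // andbT; apply/hasPn => z.
  rewrite !mem_filter => /andP [_ /andP [/eqP -> _]]; by rewrite (negbTE nfyg).
- by rewrite !filter_uniq.
move=> z; rewrite mem_cat !mem_filter /f1; case: (eqVneq (f z) (f g)) => [e|ne] /=.
  rewrite eqxx /= e [f g == _]eq_sym (negbTE nfyg) /= andbF orbF.
  by case: (eqVneq z y) => [ezy|//]; move: nfyg; rewrite -ezy e eqxx.
by rewrite andbCA.
Qed.

(** * Sums of values over lists of goods *)

Definition worth (R : realFieldType) (h : nat -> R) (s : seq nat) : R := \sum_(x <- s) h x.

Lemma worth_cons (R : realFieldType) (h : nat -> R) x s : worth h (x :: s) = h x + worth h s.
Proof. exact: big_cons. Qed.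

Lemma worth_nil (R : realFieldType) (h : nat -> R) : worth h [::] = 0.
Proof. exact: big_nil. Qed.

Lemma worth_cat (R : realFieldType) (h : nat -> R) s t : worth h (s ++ t) = worth h s + worth h t.
Proof. exact: big_cat. Qed.

Lemma worth_perm (R : realFieldType) (h : nat -> R) s t : perm_eq s t -> worth h s = worth h t.
Proof. by move=> st; exact: perm_big. Qed.

Lemma worth_ge0 (R : realFieldType) (h : nat -> R) s : (forall x, x \in s -> 0 <= h x) -> 0 <= worth h s.
Proof. by move=> h0; rewrite /worth big_seq; exact: sumr_ge0. Qed.

Lemma worth_le (R : realFieldType) (h k : nat -> R) s :
  (forall x, x \in s -> h x <= k x) -> worth h s <= worth k s.
Proof. by move=> hk; rewrite /worth [X in X <= _]big_seq [X in _ <= X]big_seq; exact: ler_sum. Qed.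

Lemma worth_mem_le (R : realFieldType) (h : nat -> R) s x :
  (forall x, x \in s -> 0 <= h x) -> x \in s -> h x <= worth h s.
Proof.
move=> h0 xs; rewrite (worth_perm h (perm_to_rem xs)) worth_cons lerDl; apply: worth_ge0 => z zr.
by apply: h0; exact: mem_rem zr.
Qed.

Lemma worth_bins (R : realFieldType) (h : nat -> R) (c : R) (f : nat -> nat) (s : seq nat) (n : nat) :
  (forall x, x \in s -> 0 <= h x) -> (forall j, (j < n)%N -> c <= worth h (bin f s j)) ->
  n%:R * c <= worth h s.
Proof.
move=> h0 hb.
apply: (@le_trans _ _ (\sum_(j < n) worth h (bin f s j))).
  rewrite mulr_natl -[X in _ *+ X]card_ord -sumr_const; apply: ler_sum => j _; exact: hb.
rewrite /worth; under eq_bigr do rewrite big_filter.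
elim: s h0 {hb} => [|x s IH] h0; first by rewrite big1 ?big_nil // => j _; rewrite big_nil.
under eq_bigr do rewrite big_cons.
have hx : 0 <= h x by apply: h0; rewrite inE eqxx.
have {IH} IH := IH (fun z zs => h0 z (mem_behead (s := x :: s) zs)).
rewrite big_cons; have [fx|fx] := ltnP (f x) n.
  rewrite (bigD1 (Ordinal fx)) //= eqxx -addrA lerD2l; apply: le_trans IH.
  rewrite [X in _ <= X](bigD1 (Ordinal fx)) //= lerD2l; apply: ler_sum => j nj.
  by case: eqP => // e; case/eqP: nj; apply: val_inj.
apply: (@le_trans _ _ (\sum_(i < n) \sum_(j <- s | f j == i) h j)); last by lra.
apply: ler_sum => j _; case: eqP => // e; have := ltn_ord j; lia.
Qed.

(** * Clean and dirty bins under the reductions *)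

Section Structures.

Variables (R : realFieldType) (v : nat -> R).

Definition clean_bin (b : seq nat) : Prop := 9 <= worth v b.

Definition boost (x : nat) : R := if 2 < v x then v x else 7 / 6 * v x.
Definition dust (x : nat) : R := if 2 < v x then 0 else v x.

(** A bin that falls short of 9 in true value must own dust worth [9 - G], hence more than 2.
    Merging supplies this dust, and the later weight bounds rely on it. *)
Definition dirty_bin (G : R) (b : seq nat) : Prop :=
  9 <= worth boost b /\ (9 <= worth v b \/ 9 - G <= worth dust b).

Definition dirty_items (G : R) (s : seq nat) : Prop :=
  [/\ 20 / 3 < G, G < 7 & forall x, x \in s -> v x <= G /\ (2 < v x \/ v x < 7 - G)].

Definition structured (s : seq nat) (n : nat) : Prop :=
  binned clean_bin s n \/ exists2 G, dirty_items G s & binned (dirty_bin G) s n.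

Lemma boostE b : worth boost b = worth v b + worth dust b / 6.
Proof.
rewrite /worth mulr_suml -big_split /=; apply: eq_bigr => x _; rewrite /boost /dust.
by case: ifP => _; field.
Qed.

Hypothesis v_ge0 : forall x, 0 <= v x.
Hypothesis v_anti : forall x y, (x <= y)%N -> v y <= v x.

Lemma dust_ge0 x : 0 <= dust x.
Proof. by rewrite /dust; case: ifP. Qed.

Lemma boost_ge0 x : 0 <= boost x.
Proof. by rewrite /boost; case: ifP => _ //; have := v_ge0 x; lra. Qed.

Lemma clean_exchangeable s : exchangeable clean_bin s.
Proof.
rewrite /clean_bin; split=> [b b' bb'|x y b _ _ xy|x b _]; rewrite ?worth_cons.
- by rewrite (worth_perm v bb').
- by have := v_anti (ltnW xy); lra.
- by have := v_ge0 x; lra.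
Qed.

(** The delicate case is a large good replacing dust. If the remaining dust drops below [9 - G],
    then the bonus of dust and the lost good, itself below 1/3, are together worth less than the 2
    gained, so the bin becomes clean. *)
Lemma dirty_exchangeable G s : dirty_items G s -> exchangeable (dirty_bin G) s.
Proof.
move=> [G1 G2 di]; rewrite /dirty_bin; split=> [b b' bb'|x y b xs ys xy|x b _].
- by rewrite !(worth_perm _ bb').
- have := v_anti (ltnW xy); have [_ dx] := di _ xs; have [_ dy] := di _ ys.
  rewrite !boostE !worth_cons /dust.
  have := v_ge0 y.
  case: (ltrP 2 (v x)) => hx; case: (ltrP 2 (v y)) => hy v0 vxy [h1 h2]; last 2 first.
  + by lra.
  + by split; [lra | case: h2; [left|right]; lra].
  + by split; [lra | case: h2; [left|right]; lra].
  + have {}hy : v y < 7 - G by case: dy => //; lra.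
    split; first by lra.
    by case: (lerP (9 - G) (worth dust b)) => hb; [right; lra | left; lra].
- rewrite !boostE !worth_cons; have := v_ge0 x; have := dust_ge0 x => h1 h2 [h3 [h4|h4]];
  by split; [lra| ((left; lra) || (right; lra))].
Qed.

Lemma structured_pigeonhole (s1 s2 s3 : seq nat) (n k : nat) :
  sorted ltn (s1 ++ s2 ++ s3) -> size s1 = (k * n)%N -> size s2 = k.+1 ->
  structured (s1 ++ s2 ++ s3) n.+1 -> structured (s1 ++ s3) n.
Proof.
move=> so z1 z2 [cl|[G di bi]].
  by left; apply: (@binned_pigeonhole _ s1 s2 s3 n k) => //; exact: clean_exchangeable.
right; exists G; last by apply: (@binned_pigeonhole _ s1 s2 s3 n k) => //; exact: dirty_exchangeable.
case: di => G1 G2 di; split=> // x; rewrite mem_cat => xs; apply: di.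
by rewrite !mem_cat; case/orP: xs => ->; rewrite ?orbT.
Qed.

(** A merged bin keeps what is left of 18 after [g] and [y] go, which is enough unless they are
    worth more than 9 together. In that case [v g > 9 - 7/3 = 20/3], goods up to [y] exceed 2 and
    goods after [y] are below [7 - v g]: the dirty structure with [G = v g]. *)
Lemma structured_pair (g y : nat) (s : seq nat) (n : nat) :
  sorted ltn (g :: s) -> y \in s -> v g < 7 -> v y < 7 / 3 ->
  (forall z, z \in s -> (y < z)%N -> v g + v z < 7) ->
  structured (g :: s) n.+1 -> structured [seq x <- g :: s | x \notin [:: g; y]] n.
Proof.
move=> so ys vg vy small st.
have us : uniq (g :: s) by apply: sorted_uniq so; [exact: ltn_trans | exact: ltnn].
have uns : uniq s by case/andP: us.
have gy : (g < y)%N by move: so => /= /(order_path_min ltn_trans) /allP /(_ _ ys).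
have vgy : v y <= v g by apply: v_anti; exact: ltnW.
have binA h f : worth h (bin f (g :: s) (f g)) = h g + worth h (bin f s (f g)).
  by rewrite /bin /= eqxx worth_cons.
have binZ (h : nat -> R) f : f y != f g -> worth h (bin f (g :: s) (f y)) =
    h y + worth h [seq x <- bin f s (f y) | x != y].
  move=> nfy; rewrite /bin /= [f g == _]eq_sym (negbTE nfy) -worth_cons; apply: worth_perm.
  apply: uniq_perm; rewrite /= ?mem_filter ?eqxx ?filter_uniq // => z.
  rewrite inE !mem_filter; case: (eqVneq z y) => [->|//] /=; by rewrite eqxx ys.
have sub_items G : dirty_items G (g :: s) -> dirty_items G [seq x <- g :: s | x \notin [:: g; y]].
  by move=> [G1 G2 di]; split=> // x; rewrite mem_filter => /andP [_ xs]; exact: di.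
have rest_dust f : 5 <= v g -> (forall p, p \in s -> f p = f g -> (y < p)%N) ->
    worth (dust) (bin f s (f g)) = worth v (bin f s (f g)).
  move=> g5 yp; rewrite /worth; apply: eq_big_seq => x; rewrite mem_filter => /andP [/eqP fx xs].
  by rewrite /dust ifF //; apply/negbTE; rewrite -leNgt; have := small _ xs (yp _ xs fx); lra.
case: st => [cl|[G di bi]]; last first.
  have [f fn If] := binned_total (dirty_exchangeable di) bi.
  right; exists G; first exact: sub_items.
  apply: (@binned_pair (dirty_bin G) (dirty_bin G) g y s n f) => //.
  - exact: dirty_exchangeable di.
  - by move=> b b' bb'; rewrite /dirty_bin !(worth_perm _ bb').
  move=> nfy yp; have [mA qA] := If _ (fn g); have [mZ qZ] := If _ (fn y).
  rewrite binA in mA; rewrite (binZ _ _ nfy) in mZ.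
  rewrite !binA in qA; rewrite !(binZ _ _ nfy) in qZ.
  rewrite /dirty_bin !worth_cat.
  have [G1 G2 dis] := di; have [gG _] := dis g (mem_head _ _).
  have [_ dy] : v y <= G /\ (2 < v y \/ v y < 7 - G) by apply: dis; rewrite inE ys orbT.
  have v0 := v_ge0 y; have g0 := v_ge0 g; rewrite !boostE in mA mZ *.
  have dA := worth_ge0 (h := dust) (s := bin f s (f g)) (fun x _ => dust_ge0 x).
  have dZ := worth_ge0 (h := dust) (s := [seq x <- bin f s (f y) | x != y]) (fun x _ => dust_ge0 x).
  have eg : boost g = v g + dust g / 6 by rewrite /boost /dust; case: ifP => _; field.
  have ey : boost y = v y + dust y / 6 by rewrite /boost /dust; case: ifP => _; field.
  rewrite eg in mA; rewrite ey in mZ.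
  (* If [y] is dust, the boosted loss is at most 7 + 7/18 out of 18. Should the true value still be
     below 9, a sixth of the dust exceeds 1, so there is ample dust. *)
  have [y2|y2] := lerP (v y) 2.
    have {}ey : dust y = v y by rewrite /dust ifF //; apply/negbTE; rewrite -leNgt.
    have {}eg : v g + dust g / 6 <= 7.
      by rewrite /dust; case: (ltrP 2 (v g)) => ?; lra.
    have ly : v y < 7 - G by case: dy => //; lra.
    rewrite ey in mZ; split; first by lra.
    have [l9|l9] := lerP 9 (worth v (bin f s (f g)) + worth v [seq x <- bin f s (f y) | x != y]).
      by left.
    by right; lra.
  have g2 : 2 < v g by lra.
  have {}ey : dust y = 0 by rewrite /dust y2.
  have {}eg : dust g = 0 by rewrite /dust g2.
  rewrite ey eg in mA mZ qA qZ.
  have [gy9|gy9] := lerP (v g + v y) 9.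
    split; first by lra.
    by case: qA => qA; case: qZ => qZ; [left | right | right | right]; lra.
  have g5 : 5 <= v g by lra.
  have eD := rest_dust f g5 yp.
  have dq : 9 - G <= worth dust (bin f s (f g)) by case: qA; lra.
  by split; [lra | right; lra].
have [f fn If] := binned_total (clean_exchangeable _) cl.
have [gy9|gy9] := lerP (v g + v y) 9.
  left; apply: (@binned_pair clean_bin clean_bin g y s n f) => //.
  - exact: clean_exchangeable.
  - by move=> b b' bb'; rewrite /clean_bin !(worth_perm _ bb').
  move=> nfy yp; have := If _ (fn g); have := If _ (fn y).
  by rewrite /clean_bin binA (binZ _ _ nfy) worth_cat; lra.
right; exists (v g).
  split; [lra | by [] |] => x; rewrite mem_filter !inE negb_or.
  case/andP => /andP [xg xy]; rewrite (negbTE xg) /= => xs.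
  split; first by apply: v_anti; apply: ltnW; move: so => /= /(order_path_min ltn_trans) /allP /(_ _ xs).
  have [ltyx|lexy] := ltnP y x; first by right; have := small _ xs ltyx; lra.
  by left; have := v_anti lexy; lra.
apply: (@binned_pair clean_bin (dirty_bin (v g)) g y s n f) => //.
- exact: clean_exchangeable.
- by move=> b b' bb'; rewrite /dirty_bin !(worth_perm _ bb').
- move=> b hb; have dA := worth_ge0 (h := dust) (s := b) (fun x _ => dust_ge0 x).
  by rewrite /clean_bin in hb; rewrite /dirty_bin boostE; split; [lra | left].
move=> nfy yp; have := If _ (fn g); have := If _ (fn y).
rewrite /clean_bin binA (binZ _ _ nfy) /dirty_bin !boostE !worth_cat => hZ hA.
have dZ := worth_ge0 (h := dust) (s := [seq x <- bin f s (f y) | x != y]) (fun x _ => dust_ge0 x).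
have g5 : 5 <= v g by lra.
have eD := rest_dust f g5 yp.
(* Origin of 7/6: the rest of the bin of [g] is dust worth at least [9 - v g > 2], so boosted it
   exceeds 7/3, more than the lost [v y]. *)
by split; [lra | right; lra].
Qed.

End Structures.

(** * Weight functions on bins *)

Section Weights.

Variable R : realFieldType.
Implicit Types (b : seq R) (P : pred R) (w : R -> R).

Lemma min_le_cases (a b c : R) : Num.min a b <= c -> a <= c \/ b <= c.
Proof. by rewrite ge_min => /orP. Qed.

Lemma le_max_cases (a b c : R) : c <= a \/ c <= b -> c <= Num.max a b.
Proof. by rewrite le_max => /orP. Qed.

Lemma le_minI (a b c : R) : c <= a -> c <= b -> c <= Num.min a b.
Proof. by rewrite le_min => -> ->. Qed.

Definition mass b : R := \sum_(x <- b) x.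
Definition weight w b : R := \sum_(x <- b) w x.

Lemma weight_nil w : weight w [::] = 0. Proof. exact: big_nil. Qed.
Lemma weight_cons w x b : weight w (x :: b) = w x + weight w b. Proof. exact: big_cons. Qed.
Lemma mass_nil : mass [::] = 0. Proof. exact: big_nil. Qed.
Lemma mass_cons x b : mass (x :: b) = x + mass b. Proof. exact: big_cons. Qed.

Lemma weight_split w P b : weight w b = weight w (filter P b) + weight w (filter (predC P) b).
Proof. by rewrite /weight !big_filter (bigID P). Qed.

Lemma mass_split P b : mass b = mass (filter P b) + mass (filter (predC P) b).
Proof. exact: weight_split. Qed.

Lemma weight_ge0 w b : (forall x, x \in b -> 0 <= w x) -> 0 <= weight w b.
Proof. by move=> h; rewrite /weight big_seq; exact: sumr_ge0. Qed.

Lemma weight_ge_mass w b : (forall x, x \in b -> x <= w x) -> mass b <= weight w b.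
Proof. by move=> h; rewrite /weight /mass [X in X <= _]big_seq [X in _ <= X]big_seq; exact: ler_sum. Qed.

(** [Num.min c] is subadditive on nonnegative reals. *)
Lemma weight_ge_min (c : R) w b : 0 <= c -> (forall x, x \in b -> 0 <= x) ->
  (forall x, x \in b -> Num.min c x <= w x) -> Num.min c (mass b) <= weight w b.
Proof.
move=> c0; elim: b => [|x b IH] b0 bw; first by rewrite mass_nil weight_nil ge_min lexx orbT.
have h1 := bw x (mem_head _ _); have h2 := b0 x (mem_head _ _).
have h3 := IH (fun z zb => b0 z (mem_behead (s := x :: b) zb))
              (fun z zb => bw z (mem_behead (s := x :: b) zb)).
have h4 : 0 <= mass b.
  rewrite /mass big_seq; apply: sumr_ge0 => z zb; by apply: b0; rewrite inE zb orbT.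
have h5 : 0 <= weight w b by apply: le_trans h3; apply: le_minI.
have h6 : 0 <= w x by apply: le_trans h1; apply: le_minI.
rewrite mass_cons weight_cons ge_min; apply/orP.
case: (min_le_cases h1) => h7; first by left; lra.
by case: (min_le_cases h3) => h8; [left|right]; lra.
Qed.

Lemma filter_facts P b (Q : R -> Prop) : (forall x, x \in b -> Q x) ->
  forall x, x \in filter P b -> P x /\ Q x.
Proof. by move=> bQ x; rewrite mem_filter => /andP [Px xb]; split=> //; exact: bQ. Qed.

(** Bin bounds are proved by the number of heavy goods; three of them nearly always suffice. *)
Lemma mem4 (b : seq R) (Q : R -> Prop) : (forall x, x \in b -> Q x) ->
  [\/ b = [::], exists2 x, b = [:: x] & Q x,
      exists x y, [/\ b = [:: x; y], Q x & Q y]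
    | exists x y z b', [/\ b = [:: x, y, z & b'], Q x, Q y, Q z & forall t, t \in b' -> Q t]].
Proof.
case: b => [|x [|y [|z b]]] h; [exact: Or41 | apply: Or42 | apply: Or43 | apply: Or44].
- by exists x => //; apply: h; rewrite inE eqxx.
- by exists x, y; split=> //; apply: h; rewrite !inE eqxx ?orbT.
- by exists x, y, z, b; split=> //; [| | |move=> t tb]; apply: h; rewrite !inE ?eqxx ?tb ?orbT.
Qed.

(** Lowering the tops by [k] is matched by capping mids, worth at most [q + k], at weight [q]. A
    top-mid pair then weighs at most [(5 - k) + q], exactly what each bin still guarantees. *)
Definition eff (q k x : R) : R := Num.min x (Num.max q (Num.min x 5 - k)).

Lemma eff_le q k x : eff q k x <= x.
Proof. by rewrite /eff ge_min lexx. Qed.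

Lemma eff_ge q k x (c : R) : c <= x -> c <= q \/ (c + k <= x /\ c + k <= 5) -> c <= eff q k x.
Proof.
move=> cx h; rewrite /eff; apply: le_minI => //; apply: le_max_cases.
by case: h => [|[h1 h2]]; [left | right; rewrite lerBrDr; exact: le_minI].
Qed.

Lemma eff_ge_min q k x : Num.min q x <= eff q k x.
Proof. by apply: eff_ge; [|left]; rewrite ge_min lexx ?orbT. Qed.

(** A good of 5 or more weighs at least [5 - k], and the rest of its bin is worth at least [q]
    because no good exceeds [9 - q]. Without such a good, every good above [q] weighs at least both
    [q] and its value minus [k], and the number of these goods decides. *)
Lemma eff_bin (q k : R) b : 2 <= q -> 0 <= k -> q + k <= 7 / 2 ->
  (forall x, x \in b -> 0 <= x <= 9 - q) -> 9 <= mass b -> 5 + q - k <= weight (eff q k) b.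
Proof.
move=> q2 k0 qk bG tb.
have [/hasP [x xb x5]|/hasPn no5] := boolP (has (fun x => 5 <= x) b).
  have pb := perm_to_rem xb.
  have tE : mass b = x + mass (rem x b) by rewrite -mass_cons; exact: perm_big.
  have wE : weight (eff q k) b = eff q k x + weight (eff q k) (rem x b).
    by rewrite -weight_cons; exact: perm_big.
  have ex : 5 - k <= eff q k x by apply: eff_ge; [lra | right; lra].
  have H : Num.min q (mass (rem x b)) <= weight (eff q k) (rem x b).
    by apply: weight_ge_min => [|z /mem_rem /bG /andP []|z _]; [lra| |exact: eff_ge_min].
  have /andP [_ xG] := bG _ xb.
  by case: (min_le_cases H) => {}H; lra.
pose P x := q < x.
have B := filter_facts (P := P) (Q := fun x => 0 <= x < 5) (b := b).
have S := filter_facts (P := predC P) (Q := fun x => 0 <= x < 5) (b := b).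
have F x : x \in b -> 0 <= x < 5.
  by move=> xb; have := bG _ xb; have := no5 _ xb; rewrite -ltNge => -> /andP [->].
have {}B := B F; have {}S := S F.
have sS : weight (eff q k) (filter (predC P) b) >= mass (filter (predC P) b).
  apply: weight_ge_mass => x /S [/=]; rewrite -leNgt => xq /andP [x0 x5].
  by apply: eff_ge => //; left.
have s0 : 0 <= mass (filter (predC P) b) by apply: weight_ge0 => x /S [_ /andP []].
have E x : P x /\ 0 <= x < 5 -> q <= eff q k x /\ x - k <= eff q k x.
  rewrite /P => -[xq /andP [x0 x5]].
  by split; apply: eff_ge; [lra | left | lra | right; lra].
move: tb sS s0; rewrite (mass_split P b) (weight_split _ P b).
have [->|[x -> hx]|[x [y [-> hx hy]]]|[x [y [z [b' [-> hx hy hz hb]]]]]] := mem4 B.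
- by rewrite mass_nil weight_nil; lra.
- by have [h1 h2] := E _ hx; rewrite !mass_cons !weight_cons mass_nil weight_nil; lra.
- have [h1 h2] := E _ hx; have [h3 h4] := E _ hy.
  by rewrite !mass_cons !weight_cons mass_nil weight_nil; lra.
- have [h1 h2] := E _ hx; have [h3 h4] := E _ hy; have [h5 h6] := E _ hz.
  rewrite !mass_cons !weight_cons; case: b' hb => [|t b'] hb.
    by rewrite mass_nil weight_nil; lra.
  have [h7 h8] := E _ (hb _ (mem_head _ _)).
  have : 0 <= weight (eff q k) b'.
    apply: weight_ge0 => u ub; have [] := E u (hb _ (mem_behead (s := t :: b') ub)); lra.
  by rewrite mass_cons weight_cons; lra.
Qed.

(** Dust keeps its full value as weight, here at least [q], and each large good weighs at least 2.
    Three large goods settle the bound; with fewer, the boosted inequality forces more dust or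
    heavier goods. *)
Lemma eff_dirty_bin (q k : R) b : 2 <= q <= 7 / 3 -> 0 <= k -> q + k <= 7 / 2 ->
  (forall x, x \in b -> 0 <= x <= 9 - q) ->
  let L := mass (filter (fun x : R => 2 < x) b) in
  let D := mass (filter (predC (fun x : R => 2 < x)) b) in
  9 <= L + 7 / 6 * D -> 9 <= L + D \/ q <= D -> 5 + q - k <= weight (eff q k) b.
Proof.
move=> /andP [q2 q73] k0 qk bG L D mb [] hD.
  by apply: eff_bin => //; rewrite (mass_split (fun x : R => 2 < x) b).
pose P (x : R) : bool := 2 < x.
have qD : q <= D by [].
have B := filter_facts (P := P) bG; have S := filter_facts (P := predC P) bG.
have sS : weight (eff q k) (filter (predC P) b) >= D.
  apply: weight_ge_mass => x /S [/=]; rewrite -leNgt => xq /andP [x0 x5].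
  by apply: eff_ge => //; left; lra.
have E x : P x /\ 0 <= x <= 9 - q -> 2 <= eff q k x /\ (x - k <= eff q k x \/ 5 - k <= eff q k x).
  rewrite /P => -[xq /andP [x0 x5]].
  split; first by apply: eff_ge; [lra | left].
  have [x5'|x5'] := lerP x 5; [left|right]; apply: eff_ge; try lra; right; lra.
move: sS mb; rewrite (weight_split _ P b) /L; clear L.
have [->|[x -> hx]|[x [y [-> hx hy]]]|[x [y [z [b' [-> hx hy hz hb]]]]]] := mem4 B.
- by rewrite mass_nil weight_nil; lra.
- have [h1 h2] := E _ hx; rewrite !mass_cons !weight_cons mass_nil weight_nil.
  by case: h2; lra.
- have [h1 h2] := E _ hx; have [h3 h4] := E _ hy.
  rewrite !mass_cons !weight_cons mass_nil weight_nil.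
  have [k1|k1] := lerP 1 k; first by lra.
  have [D4|D4] := lerP D 4; last by lra.
  by case: h2 => h2; case: h4 => h4; lra.
- have [h1 h2] := E _ hx; have [h3 h4] := E _ hy; have [h5 h6] := E _ hz.
  have : 0 <= weight (eff q k) b'.
    apply: weight_ge0 => u ub; have [] := E u (hb _ ub); lra.
  by rewrite !mass_cons !weight_cons; lra.
Qed.

(* Each [sch*] lets every bin worth 9, of goods below 5, weigh at least 3 (resp. 4); [c] plays
   the role of the best mid, [g] that of the gap left by an overfull bag. *)
Definition sch3 (x : R) : R := if x < 1 then x else Num.max 1 (x - 3).

Definition sch4 (c x : R) : R :=
  if x < 1 then x
  else if x <= c then 1 + Num.min (c - 8 / 3) (Num.max 0 (x - 7 / 3))
  else if x <= 7 - c then 2 - (c - 8 / 3) else 2 + (c - 8 / 3).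

Definition sch4s (g x : R) : R :=
  if x < 1 then Num.min 1 (x / (3 * g)) else if x <= 3 - g then 1 else 2.

(** With exactly two goods of at least 1, the bound [x - 3] on each gives 9 - 6; a single one is
    below 5 and leaves more than 4 in small goods. *)
Lemma sch3_bin b : (forall x, x \in b -> 0 <= x < 5) -> 9 <= mass b -> 3 <= weight sch3 b.
Proof.
move=> b5 tb; pose P (x : R) : bool := 1 <= x.
have B := filter_facts (P := P) b5; have S := filter_facts (P := predC P) b5.
have sS : weight sch3 (filter (predC P) b) >= mass (filter (predC P) b).
  by apply: weight_ge_mass => x /S [/=]; rewrite -ltNge /sch3 => -> _.
have E x : P x /\ 0 <= x < 5 -> 1 <= sch3 x /\ x - 3 <= sch3 x.
  rewrite /P => -[x1 _]; by rewrite /sch3 ltNge x1 /=; split; apply: le_max_cases; [left|right].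
move: tb sS; rewrite (mass_split P b) (weight_split _ P b).
have [->|[x -> hx]|[x [y [-> hx hy]]]|[x [y [z [b' [-> hx hy hz hb]]]]]] := mem4 B.
- by rewrite mass_nil weight_nil; lra.
- have [h1 h2] := E _ hx; case: hx => _ /andP [x0 x5].
  by rewrite !mass_cons !weight_cons mass_nil weight_nil; lra.
- have [h1 h2] := E _ hx; have [h3 h4] := E _ hy.
  by rewrite !mass_cons !weight_cons mass_nil weight_nil; lra.
- have [h1 h2] := E _ hx; have [h3 h4] := E _ hy; have [h5 h6] := E _ hz.
  have : 0 <= weight sch3 b'.
    by apply: weight_ge0 => u ub; have [] := E u (hb _ ub); lra.
  have : 0 <= mass (filter (predC P) b) by apply: weight_ge0 => u /S [_ /andP []].
  by rewrite !weight_cons; lra.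
Qed.

(** A single good of at least 1 takes at most 3 and leaves more than 1 in goods that weigh at least
    their value. *)
Lemma two_units (w : R -> R) (c : R) b : 1 <= c <= 3 -> (forall x, x \in b -> 0 <= x <= c) ->
  (forall x, 1 <= x <= c -> 1 <= w x) -> (forall x, 0 <= x < 1 -> x <= w x) ->
  4 < mass b -> 2 <= weight w b.
Proof.
move=> /andP [c1 c3] bc w1 w0 tb; pose P (x : R) : bool := 1 <= x.
have B := filter_facts (P := P) bc; have S := filter_facts (P := predC P) bc.
have sS : weight w (filter (predC P) b) >= mass (filter (predC P) b).
  by apply: weight_ge_mass => x /S [/=]; rewrite -ltNge => x1 /andP [x0 _]; apply: w0; rewrite x0.
have s0 : 0 <= mass (filter (predC P) b) by apply: weight_ge0 => u /S [_ /andP []].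
have E x : P x /\ 0 <= x <= c -> 1 <= w x.
  by rewrite /P => -[x1 /andP [_ xc]]; apply: w1; rewrite x1.
move: tb sS s0; rewrite (mass_split P b) (weight_split _ P b).
have [->|[x -> hx]|[x [y [-> hx hy]]]|[x [y [z [b' [-> hx hy hz hb]]]]]] := mem4 B.
- by rewrite mass_nil weight_nil; lra.
- have h := E _ hx; case: hx => _ /andP [_ xc].
  by rewrite !mass_cons !weight_cons mass_nil weight_nil; lra.
- have h1 := E _ hx; have h2 := E _ hy.
  by rewrite !mass_cons !weight_cons mass_nil weight_nil; lra.
- have h1 := E _ hx; have h2 := E _ hy; have h3 := E _ hz.
  have : 0 <= weight w b' by apply: weight_ge0 => u ub; have := E u (hb _ ub); lra.
  by rewrite !weight_cons; lra.
Qed.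

Lemma sch4s_ge_min (g x : R) : 0 < g <= 1 / 3 -> 0 <= x -> Num.min 1 x <= sch4s g x.
Proof.
move=> /andP [g0 g1] x0; rewrite /sch4s; case: ifP => _; last first.
  by case: ifP => _; rewrite ge_min; apply/orP; left; lra.
have h : x <= x / (3 * g) by rewrite ler_pdivlMr; nra.
by apply: le_minI; rewrite ge_min ?lexx // h orbT.
Qed.

Lemma sch4s_bin (g : R) b : 0 < g <= 1 / 3 ->
  (forall x, x \in b -> 0 <= x < 5) -> 9 <= mass b -> 4 <= weight (sch4s g) b.
Proof.
move=> g01 b5 tb; have /andP [g0 g1] := g01; pose P (x : R) : bool := 3 - g < x.
have B := filter_facts (P := P) b5; have S := filter_facts (P := predC P) b5.
have S' x : x \in filter (predC P) b -> 0 <= x <= 3 - g.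
  by move=> /S [/=]; rewrite -leNgt => -> /andP [-> _].
have w1 x : 1 <= x <= 3 - g -> 1 <= sch4s g x.
  by move=> /andP [x1 x3]; rewrite /sch4s ltNge x1 /= x3.
have w0 x : 0 <= x < 1 -> x <= sch4s g x.
  by move=> /andP [x0 x1]; apply: le_trans (sch4s_ge_min g01 x0); apply: le_minI => //; lra.
have E x : P x /\ 0 <= x < 5 -> sch4s g x = 2.
  by rewrite /P => -[x3 _]; rewrite /sch4s (lt_geF x3) le_gtF //; lra.
have sw : 0 <= weight (sch4s g) (filter (predC P) b).
  by apply: weight_ge0 => x /S' /andP [x0 _]; apply: le_trans (sch4s_ge_min g01 x0); apply: le_minI.
move: tb; rewrite (mass_split P b) (weight_split _ P b).
have [->|[x -> hx]|[x [y [-> hx hy]]]|[x [y [z [b' [-> hx hy hz hb]]]]]] := mem4 B; last 3 first.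
- rewrite !weight_cons !mass_cons mass_nil weight_nil (E _ hx); case: hx => _ /andP [_ x5] tb.
  suff : 2 <= weight (sch4s g) (filter (predC P) b) by lra.
  by apply: (two_units (c := 3 - g)) => //; lra.
- by rewrite !weight_cons weight_nil (E _ hx) (E _ hy); lra.
- have : 0 <= weight (sch4s g) b' by apply: weight_ge0 => u ub; rewrite (E u (hb _ ub)).
  by rewrite !weight_cons (E _ hx) (E _ hy) (E _ hz); lra.
rewrite mass_nil weight_nil !add0r => {B E}.
move: (filter (predC P) b) S' sw => c c3 _ tc {S}.
pose Q (x : R) : bool := 1 <= x.
have B := filter_facts (P := Q) c3; have S := filter_facts (P := predC Q) c3.
have s0 : 0 <= mass (filter (predC Q) c) by apply: weight_ge0 => u /S [_ /andP []].
have sS : weight (sch4s g) (filter (predC Q) c) >= mass (filter (predC Q) c).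
  by apply: weight_ge_mass => x /S [/=]; rewrite -ltNge => x1 /andP [x0 _]; apply: w0; rewrite x0.
have sM : weight (sch4s g) (filter (predC Q) c) >= Num.min 1 (mass (filter (predC Q) c) / (3 * g)).
  have -> : mass (filter (predC Q) c) / (3 * g) = mass [seq x / (3 * g) | x <- filter (predC Q) c].
    by rewrite /mass big_map mulr_suml.
  have -> : weight (sch4s g) (filter (predC Q) c) =
      weight (fun y => sch4s g (y * (3 * g))) [seq x / (3 * g) | x <- filter (predC Q) c].
    rewrite /weight big_map; apply: eq_bigr => x _; rewrite divfK //; lra.
  apply: weight_ge_min => // y /mapP [x /S [/= x1 /andP [x0 _]] ->].
    by rewrite divr_ge0 //; lra.
  by rewrite divfK; [rewrite /sch4s ltNge x1 | lra].
have E x : Q x /\ 0 <= x <= 3 - g -> sch4s g x = 1.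
  by rewrite /Q => -[x1 /andP [_ x3]]; rewrite /sch4s ltNge x1 /= x3.
move: tc s0 sS sM; rewrite (mass_split Q c) (weight_split _ Q c).
have [->|[x -> hx]|[x [y [-> hx hy]]]|[x [y [z [b' [-> hx hy hz hb]]]]]] := mem4 B.
- by rewrite mass_nil weight_nil; lra.
- rewrite !weight_cons !mass_cons mass_nil weight_nil (E _ hx); case: hx => _ /andP [_ hx]; lra.
- rewrite !weight_cons !mass_cons mass_nil weight_nil (E _ hx) (E _ hy).
  by case: hx => _ /andP [_ hx]; case: hy => _ /andP [_ hy]; lra.
case: b' hb => [|t b'] hb.
  rewrite !weight_cons !mass_cons mass_nil weight_nil (E _ hx) (E _ hy) (E _ hz).
  case: hx => _ /andP [_ hx]; case: hy => _ /andP [_ hy]; case: hz => _ /andP [_ hz] h1 h2 _ h3.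
  (* Origin of [3 * g]: three goods of at most [3 - g] leave at least [3 * g] in small goods, which
     must supply the fourth unit. *)
  have h4 : 1 <= mass (filter (predC Q) c) / (3 * g) by rewrite ler_pdivlMr; lra.
  by case: (min_le_cases h3) => {}h3; lra.
have : 0 <= weight (sch4s g) b'.
  by apply: weight_ge0 => u ub; rewrite (E u (hb _ (mem_behead (s := t :: b') ub))).
by rewrite !weight_cons (E _ hx) (E _ hy) (E _ hz) (E _ (hb _ (mem_head _ _))); lra.
Qed.

Lemma sch4_bin (c : R) b : 8 / 3 < c < 3 ->
  (forall x, x \in b -> 0 <= x < 5) -> 9 <= mass b -> 4 <= weight (sch4 c) b.
Proof.
move=> /andP [c8 c3] b5 tb; pose P (x : R) : bool := c < x.
have B := filter_facts (P := P) b5; have S := filter_facts (P := predC P) b5.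
have S' x : x \in filter (predC P) b -> 0 <= x <= c.
  by move=> /S [/=]; rewrite -leNgt => -> /andP [-> _].
have w1 x : 1 <= x <= c -> 1 <= sch4 c x.
  move=> /andP [x1 xc]; rewrite /sch4 ltNge x1 xc /= lerDl; apply: le_minI; first by lra.
  by apply: le_max_cases; left.
have w0 x : 0 <= x < 1 -> x <= sch4 c x by move=> /andP [_ x1]; rewrite /sch4 x1.
have E x : P x /\ 0 <= x < 5 -> (x <= 7 - c /\ sch4 c x = 2 - (c - 8 / 3)) \/
    sch4 c x = 2 + (c - 8 / 3).
  rewrite /P => -[xc _]; rewrite /sch4 (lt_geF xc) le_gtF; last by lra.
  by case: ifP => h; [left|right].
have sm x : x \in filter (predC P) b -> Num.min 1 x <= sch4 c x.
  move=> /S' /andP [x0 xc]; have [x1|] := boolP (x < 1); last rewrite -leNgt => x1.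
    by have := w0 x; rewrite x0 x1 => /(_ isT) h; rewrite ge_min h orbT.
  by have := w1 x; rewrite x1 xc => /(_ isT) h; rewrite ge_min h.
have sM : Num.min 1 (mass (filter (predC P) b)) <= weight (sch4 c) (filter (predC P) b).
  by apply: weight_ge_min => // x /S' /andP [].
have s0 : 0 <= mass (filter (predC P) b) by apply: weight_ge0 => u /S' /andP [].
have cc : 1 <= c <= 3 by lra.
have two := two_units cc S' w1 w0.
move: tb s0 sM; rewrite (mass_split P b) (weight_split _ P b).
have [-> tb s0 _|[x -> hx]|[x [y [-> hx hy]]]|[x [y [z [b' [-> hx hy hz hb]]]]]] := mem4 B; last 3 first.
- rewrite !weight_cons !mass_cons mass_nil weight_nil => tb s0 _.
  case: (E _ hx) => [[x7 ->]|->]; last first.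
    by case: hx => _ /andP [_ x5]; have := two; lra.
  have {}tb : 2 + c <= mass (filter (predC P) b) by lra.
  (* The heavy good is at most [7 - c], so the rest is worth at least [2 + c] and has to make up for
     [2 - (c - 8 / 3)]. Two goods weighing at least their value minus 4/3, plus small ones, give
     [2 + c - 8/3]; this is where 8/3 comes from. *)
  suff : 2 + (c - 8 / 3) <= weight (sch4 c) (filter (predC P) b) by lra.
  move: (filter (predC P) b) S' tb s0 => d d3 td s0 {S B sm two}.
  pose Q (x : R) : bool := 1 <= x.
  have B := filter_facts (P := Q) d3; have S := filter_facts (P := predC Q) d3.
  have sS : weight (sch4 c) (filter (predC Q) d) >= mass (filter (predC Q) d).
    by apply: weight_ge_mass => u /S [/=]; rewrite -ltNge => u1 /andP [u0 _]; apply: w0; rewrite u0.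
  have t0 : 0 <= mass (filter (predC Q) d) by apply: weight_ge0 => u /S [_ /andP []].
  have F1 u : Q u /\ 0 <= u <= c -> 1 <= sch4 c u.
    by rewrite /Q => -[u1 /andP [_ uc]]; apply: w1; rewrite u1.
  have F u : Q u /\ 0 <= u <= c -> 1 + (c - 8 / 3) <= sch4 c u \/ u - 4 / 3 <= sch4 c u.
    rewrite /Q => -[u1 /andP [_ uc]]; rewrite /sch4 ltNge u1 uc /=.
    have [h|h] := lerP (c - 8 / 3) (u - 7 / 3); [left|right].
      by rewrite lerD2l; apply: le_minI => //; apply: le_max_cases; right.
    rewrite -lerBlDl; apply: le_minI; first by lra.
    by apply: le_max_cases; right; lra.
  move: td sS t0; rewrite (mass_split Q d) (weight_split _ Q d).
  have [->|[y -> hy]|[y [z [-> hy hz]]]|[y [z [t [b' [-> hy hz ht hb]]]]]] := mem4 B.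
  + by rewrite mass_nil weight_nil; lra.
  + rewrite !weight_cons !mass_cons mass_nil weight_nil; have := F1 _ hy.
    by case: hy => _ /andP [_ yc]; lra.
  + rewrite !weight_cons !mass_cons mass_nil weight_nil.
    have ? := F1 _ hy; have ? := F1 _ hz.
    by case: (F _ hy) => ?; case: (F _ hz) => ?; lra.
  have : 0 <= weight (sch4 c) b' by apply: weight_ge0 => u ub; have := F1 u (hb _ ub); lra.
  by have := F1 _ hy; have := F1 _ hz; have := F1 _ ht; rewrite !weight_cons; lra.
- rewrite !weight_cons !mass_cons mass_nil weight_nil => tb s0 sM.
  have {}sM : 0 <= weight (sch4 c) (filter (predC P) b) /\
      (1 <= weight (sch4 c) (filter (predC P) b) \/
       mass (filter (predC P) b) <= weight (sch4 c) (filter (predC P) b)).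
    by split; [apply: le_trans sM; apply: le_minI | exact: min_le_cases].
  move: sM => [sM0 sM].
  by case: (E _ hx) => [[x7 ->]|->]; case: (E _ hy) => [[y7 ->]|->]; case: sM => sM; lra.
- have E' u : P u /\ 0 <= u < 5 -> 5 / 3 <= sch4 c u.
    by move=> /E [[_ ->]|->]; lra.
  have : 0 <= weight (sch4 c) b' by apply: weight_ge0 => u ub; have := E' u (hb _ ub); lra.
  have := E' _ hx; have := E' _ hy; have := E' _ hz => h1 h2 h3 h4 _ s0 sM.
  have {}sM : 0 <= weight (sch4 c) (filter (predC P) b) by apply: le_trans sM; apply: le_minI.
  by rewrite !weight_cons; lra.
move: tb s0; rewrite mass_nil weight_nil !add0r => td s0 {B E sm two}.
move: (filter (predC P) b) S' td s0 => d d3 td s0 {S}.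
pose Q (x : R) : bool := 1 <= x.
have B := filter_facts (P := Q) d3; have S := filter_facts (P := predC Q) d3.
have sS : weight (sch4 c) (filter (predC Q) d) >= mass (filter (predC Q) d).
  by apply: weight_ge_mass => u /S [/=]; rewrite -ltNge => u1 /andP [u0 _]; apply: w0; rewrite u0.
have t0 : 0 <= mass (filter (predC Q) d) by apply: weight_ge0 => u /S [_ /andP []].
(* The bound [u - 5 / 3] is tight at [u = c]; with three such goods it gives 9 - 5 = 4. *)
have F u : Q u /\ 0 <= u <= c -> 1 <= sch4 c u /\ u - 5 / 3 <= sch4 c u.
  rewrite /Q => -[u1 /andP [_ uc]]; split; first by apply: w1; rewrite u1.
  rewrite /sch4 ltNge u1 uc /= -lerBlDl; apply: le_minI; first by lra.
  by apply: le_max_cases; right; lra.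
move: td sS t0; rewrite (mass_split Q d) (weight_split _ Q d).
have [->|[x -> hx]|[x [y [-> hx hy]]]|[x [y [z [b' [-> hx hy hz hb]]]]]] := mem4 B.
- by rewrite mass_nil weight_nil; lra.
- rewrite !weight_cons !mass_cons mass_nil weight_nil; have [] := F _ hx.
  by case: hx => _ /andP [_ xc]; lra.
- rewrite !weight_cons !mass_cons mass_nil weight_nil; have [? ?] := F _ hx; have [? ?] := F _ hy.
  by case: hx => _ /andP [_ xc]; case: hy => _ /andP [_ yc]; lra.
have [? ?] := F _ hx; have [? ?] := F _ hy; have [? ?] := F _ hz.
case: b' hb => [|t b'] hb.
  by rewrite !weight_cons !mass_cons mass_nil weight_nil; lra.
have : 0 <= weight (sch4 c) b'.
  by apply: weight_ge0 => u ub; have [] := F u (hb _ (mem_behead (s := t :: b') ub)); lra.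
have [? _] := F _ (hb _ (mem_head _ _)).
by rewrite !weight_cons; lra.
Qed.

(** Dust counts in full and is worth at least 2, so two large goods suffice. A single one is below
    5, so the boosted inequality forces dust above 3. *)
Lemma count_dirty_bin (w : R -> R) b :
  (forall x, 0 <= x -> Num.min 1 x <= w x) ->
  (forall x, x \in b -> 0 <= x < 5 /\ (2 < x \/ x < 1)) ->
  let L := mass (filter (fun x : R => 2 < x) b) in
  let D := mass (filter (predC (fun x : R => 2 < x)) b) in
  9 <= L + 7 / 6 * D -> 2 <= D -> 4 <= weight w b.
Proof.
move=> wm bd L D mb D2.
pose P (x : R) : bool := 2 < x.
have B := filter_facts (P := P) bd; have S := filter_facts (P := predC P) bd.
have sS : weight w (filter (predC P) b) >= D.
  apply: weight_ge_mass => x /S [/=]; rewrite /P => x2 [/andP [x0 _] [|x1]]; first by rewrite (negbTE x2).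
  by case: (min_le_cases (wm x x0)) => // h; lra.
have E x : P x /\ (0 <= x < 5 /\ (2 < x \/ x < 1)) -> 1 <= w x /\ x < 5.
  rewrite /P => -[x2 [/andP [x0 x5] _]]; split=> //.
  by case: (min_le_cases (wm x x0)) => // h; lra.
move: mb sS; rewrite /L (weight_split _ P b).
have [->|[x -> hx]|[x [y [-> hx hy]]]|[x [y [z [b' [-> hx hy hz hb]]]]]] := mem4 B.
- by rewrite mass_nil weight_nil; lra.
- have [? ?] := E _ hx.
  by rewrite !weight_cons !mass_cons mass_nil weight_nil; lra.
- have [? ?] := E _ hx; have [? ?] := E _ hy.
  by rewrite !weight_cons weight_nil; lra.
have [? ?] := E _ hx; have [? ?] := E _ hy; have [? ?] := E _ hz.
have : 0 <= weight w b' by apply: weight_ge0 => u ub; have [] := E u (hb _ ub); lra.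
by rewrite !weight_cons; lra.
Qed.

End Weights.

Lemma worth_rcons (R : realFieldType) (h : nat -> R) s x : worth h (rcons s x) = worth h s + h x.
Proof. by rewrite -cats1 worth_cat worth_cons worth_nil addr0. Qed.

Lemma natrS_mul (R : realFieldType) (n : nat) (c : R) : n.+1%:R * c = n%:R * c + c.
Proof. by rewrite -[n.+1]addn1 natrD mulrDl mul1r. Qed.

Lemma pairs_worth_le (R : realFieldType) (h : nat -> R) (c : R) (T M : seq nat) :
  size T = size M -> (forall t u, t \in T -> u \in M -> h t + h u <= c) ->
  worth h T + worth h M <= (size T)%:R * c.
Proof.
elim: T M => [|t T IH] [|u M] //= => [_ _|[zTM] H]; first by rewrite !worth_nil; lra.
have h1 := H t u (mem_head _ _) (mem_head _ _).
have h2 : worth h T + worth h M <= (size T)%:R * c.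
  by apply: IH => // t' u' tT uM; apply: H; rewrite inE ?tT ?uM orbT.
by rewrite !worth_cons natrS_mul; lra.
Qed.

(** * Filling bags *)

Section AgentInvariants.

Variables (R : realFieldType) (v : nat -> R).
Hypothesis v_ge0 : forall x, 0 <= v x.
Hypothesis v_anti : forall x y, (x <= y)%N -> v y <= v x.

Implicit Types (T M F D : seq nat) (n : nat).

(* The bag is worth less than 7 before its last fill, which is worth at most [f], and its top
   loses [k]: its weight is at most [7 + f - k]. *)
Definition linear_inv n T M F : Prop :=
  exists w : nat -> R, exists k f tot : R,
  [/\ (forall x, w x <= v x) /\ (forall t, t \in T -> w t <= v t - k),
      0 <= f, forall x, x \in F -> v x <= f, 7 + f - k <= tot
    & n%:R * tot <= worth w (T ++ M ++ F)].

(** The clauses price the three kinds of bag at [tot] or less: a pair with one fill, a cheap pair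
    with two fills, and a pair with tiny fills. Fills worth less than [g] in total weigh less than
    1/2 together, leaving 1/2 for a tiny last fill. *)
Definition scheme (g : R) n T M F : Prop :=
  exists w : nat -> R, exists tot : R,
  [/\ n%:R * tot <= worth w (T ++ M ++ F),
      forall t u, t \in T -> u \in M -> w t + w u <= tot - 1,
      forall x, x \in F -> w x <= 1 /\ (v x < g -> w x <= v x / (2 * g))
    & forall t u, t \in T -> u \in M -> v t + v u < 5 - g -> w t + w u <= tot - 2].

Definition large_goods T M F : Prop :=
  [/\ forall t, t \in T -> 2 < v t < 5, forall u, u \in M -> 2 < v u < 7 / 2
    & forall x, x \in F -> v x < 7 / 3].

(** [m] is instantiated by [v] for clean structures and by [boost v] for dirty ones. *)
Definition measure_ok (m : nat -> R) F : Prop :=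
  (forall x, v x <= m x <= 7 / 6 * v x /\ (2 < v x -> m x = v x)) /\
  ((forall x, m x = v x) \/ (forall x, x \in F -> 2 < v x \/ v x < 1 / 3)).

Definition nlarge F : nat := count (fun x => 2 < v x) F.

(** A potential argument: a bag with [j] large fills may cost [9 - 1/3 + j/3], because removing it
    lowers [n - nlarge] by [1 - j]. *)
Definition budget (m : nat -> R) n T M F : Prop :=
  n%:R * 9 <= worth m (T ++ M ++ F) + (n%:R - (nlarge F)%:R) / 3.

(** The last two alternatives exclude bags with two large fills: a pair worth 5 needs only one fill
    above 2 to pass 7. *)
Definition calm m n T M F : Prop :=
  n%:R * 9 <= worth m (T ++ M ++ F) /\
  [\/ budget m n T M F,
      forall t u, t \in T -> u \in M -> 5 <= v t + v u
    | forall x, x \in F -> v x <= 2].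

(** The state after a bag of four large goods has passed 9. The plain bound of 9 per agent may fail,
    but [budget] survives, and a bag without large fills now ends with a fill below 1/3. *)
Definition quartic m n T M F : Prop :=
  budget m n T M F /\ (forall x, x \in F -> 2 < v x \/ v x < 1 / 3).

(* Once a single large fill has brought a bag above 9, summing values no longer suffices and the
   count [scheme] takes over. *)
Definition before_overshoot n T M F : Prop :=
  (exists2 m, measure_ok m F & calm m n T M F \/ quartic m n T M F) /\
  (forall g, 0 < g < 1 / 3 -> (exists2 x, x \in F & 2 + g <= v x) -> scheme g n T M F).

Definition after_overshoot n T M F : Prop :=
  exists g, [/\ 0 < g < 1 / 3, scheme g n T M F,
    forall t u, t \in T -> u \in M -> 7 - g < v t + v u
  & forall x, x \in F -> 2 < v x \/ v x < g].

Definition large_inv n T M F : Prop :=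
  large_goods T M F /\ (before_overshoot n T M F \/ after_overshoot n T M F).

Definition agent_inv n T M F : Prop :=
  (forall t u, t \in T -> u \in M -> v t + v u < 7) /\
  (linear_inv n T M F \/ large_inv n T M F).

Lemma worth_remove h T M D F1 F2 t u x :
  worth h (rcons T t ++ rcons M u ++ D ++ F1 ++ x :: F2) =
  worth h (T ++ M ++ F1 ++ F2) + (h t + h u + worth h D + h x) :> R.
Proof. by rewrite !worth_cat !worth_rcons worth_cons; ring. Qed.

(** * Effect of one bag on an agent who does not get it *)

Section Step.

Variables (n : nat) (T M D F1 F2 : seq nat) (t u x : nat).
Let F := D ++ F1 ++ x :: F2.
Hypothesis sorted_goods : sorted ltn (rcons T t ++ rcons M u ++ F).
Hypothesis under : v t + v u + worth v D < 7.
Hypothesis after_under : forall y, y \in F2 -> v t + v u + worth v D + v y < 7.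

Lemma mem_fill y : y \in F1 ++ F2 -> y \in F.
Proof. by rewrite /F !mem_cat inE => /orP [->|->]; rewrite ?orbT. Qed.

Lemma mem_last_fill : x \in F.
Proof. by rewrite /F !mem_cat inE eqxx !orbT. Qed.

Lemma mem_first_fill y : y \in D -> y \in F.
Proof. by rewrite /F !mem_cat => ->. Qed.

Lemma mem_tops y : y \in T -> y \in rcons T t.
Proof. by rewrite mem_rcons inE => ->; rewrite orbT. Qed.

Lemma mem_mids y : y \in M -> y \in rcons M u.
Proof. by rewrite mem_rcons inE => ->; rewrite orbT. Qed.

Lemma top_last : t \in rcons T t. Proof. by rewrite mem_rcons mem_head. Qed.
Lemma mid_last : u \in rcons M u. Proof. by rewrite mem_rcons mem_head. Qed.

Lemma v_first y z : y \in D -> z \in F1 ++ x :: F2 -> v z <= v y.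
Proof.
move=> yD zF; apply/v_anti/ltnW.
move: sorted_goods; rewrite /F !catA -!catA catA => so.
have : sorted ltn (D ++ F1 ++ x :: F2) by apply: (subseq_sorted ltn_trans _ so); exact: suffix_subseq.
by move/ltn_sorted_cat; apply.
Qed.

Lemma v_skipped y : y \in F1 -> v x <= v y.
Proof.
move=> yF; apply/v_anti/ltnW; move: sorted_goods; rewrite /F !catA -!catA catA => so.
have : sorted ltn (F1 ++ x :: F2).
  apply: (subseq_sorted ltn_trans _ so).
  by rewrite catA; exact: suffix_subseq.
by move/ltn_sorted_cat; apply; rewrite ?mem_head.
Qed.

Lemma v_top y : y \in T -> v t <= v y.
Proof.
move=> yT; apply/v_anti/ltnW; move: sorted_goods; rewrite cat_rcons => so.
by move/ltn_sorted_cat: so; apply; rewrite ?mem_head.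
Qed.

Lemma v_mid y : y \in M -> v u <= v y.
Proof.
move=> yM; apply/v_anti/ltnW; move: sorted_goods => so.
have : sorted ltn (rcons M u ++ F) by apply: (subseq_sorted ltn_trans _ so); exact: suffix_subseq.
by rewrite cat_rcons => /ltn_sorted_cat; apply; rewrite ?mem_head.
Qed.

Lemma linear_step : linear_inv n.+1 (rcons T t) (rcons M u) F -> linear_inv n T M (F1 ++ F2).
Proof.
case=> w [k [f [tot [[wv wt] f0 Ff le_tot]]]]; rewrite worth_remove => tw.
exists w, k, f, tot; split=> //.
- by split=> // y yT; apply: wt; exact: mem_tops.
- by move=> y yF; apply: Ff; exact: mem_fill.
have un := under; have h1 := wt t top_last; have h2 := wv u; have h4 := wv x; have h5 := Ff x mem_last_fill.
have h3 : worth w D <= worth v D by apply: worth_le => *; exact: wv.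
by move: tw; rewrite natrS_mul; lra.
Qed.

Lemma scheme_step g : scheme g n.+1 (rcons T t) (rcons M u) F ->
  (forall w tot,
     w t + w u <= tot - 1 ->
     (forall y, y \in F -> w y <= 1 /\ (v y < g -> w y <= v y / (2 * g))) ->
     (v t + v u < 5 - g -> w t + w u <= tot - 2) ->
     w t + w u + worth w D + w x <= tot) ->
  scheme g n T M (F1 ++ F2).
Proof.
case=> w [tot [tw pw fw bw]] H; exists w, tot; split.
- have := H w tot (pw _ _ top_last mid_last) fw (bw _ _ top_last mid_last).
  by move: tw; rewrite worth_remove natrS_mul; lra.
- by move=> t' u' tT uM; apply: pw; [exact: mem_tops | exact: mem_mids].
- by move=> y yF; apply: fw; exact: mem_fill.
- by move=> t' u' tT uM; apply: bw; [exact: mem_tops | exact: mem_mids].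
Qed.

(** The pair exceeds [7 - g], so a nonempty [D] is worth less than [g]; then [D] and the still
    smaller [x] weigh less than 1/2 each. *)
Lemma after_overshoot_step :
  after_overshoot n.+1 (rcons T t) (rcons M u) F -> after_overshoot n T M (F1 ++ F2).
Proof.
case=> g [/andP [g0 g3] sc pg fg]; exists g; split; first by rewrite g0.
- apply: (scheme_step sc) => w tot pw fw _.
  have un := under; have [wx1 wxg] := fw _ mem_last_fill.
  have P7 := pg _ _ top_last mid_last.
  have v0 := v_ge0 x.
  case: (posnP (size D)) => [/size0nil ->|Dp]; first by rewrite worth_nil; lra.
  have vDg : worth v D < g by lra.
  have Dg y : y \in D -> v y < g by move=> yD; have := worth_mem_le (h := v) (fun z _ => v_ge0 z) yD; lra.
  have wD : worth w D <= worth v D / (2 * g).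
    rewrite /worth mulr_suml -!/(worth _ _); apply: worth_le => y yD.
    by have [_] := fw _ (mem_first_fill yD); apply; exact: Dg.
  have d1 : nth 0%N D 0 \in D by rewrite mem_nth.
  have xg : v x < g.
    by apply: le_lt_trans (Dg _ d1); apply: v_first => //; rewrite mem_cat mem_head orbT.
  have h1 : worth v D / (2 * g) < 1 / 2 by rewrite ltr_pdivrMr; lra.
  have h2 : v x / (2 * g) < 1 / 2 by rewrite ltr_pdivrMr; lra.
  by have := wxg xg; lra.
- by move=> t' u' tT uM; apply: pg; [exact: mem_tops | exact: mem_mids].
- by move=> y yF; apply: fg; exact: mem_fill.
Qed.

Lemma nlarge_fill : nlarge F = (nlarge D + (2 < v x)%R + nlarge (F1 ++ F2))%N.
Proof. by rewrite /nlarge /F !count_cat /=; lia. Qed.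

Lemma budget_step m : budget m n.+1 (rcons T t) (rcons M u) F ->
  m t + m u + worth m D + m x <= 9 - 1 / 3 + ((nlarge D)%:R + (2 < v x)%R%:R) / 3 ->
  budget m n T M (F1 ++ F2).
Proof.
rewrite /budget worth_remove nlarge_fill natrS_mul -[n.+1]addn1 !natrD => h1 h2.
by move: h1 h2; move: (n%:R * 9) (worth m _) => A B h1 h2; lra.
Qed.

Section LargeStep.

Hypothesis goods_top : forall y, y \in rcons T t -> 2 < v y < 5.
Hypothesis goods_mid : forall y, y \in rcons M u -> 2 < v y < 7 / 2.
Hypothesis goods_fill : forall y, y \in F -> v y < 7 / 3.

Lemma pair_gt4 : 2 < v t /\ 2 < v u.
Proof. by have /andP [? _] := goods_top top_last; have /andP [? _] := goods_mid mid_last. Qed.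

(** All of [D] is at least as good as [z]; two fills above 2 on top of a pair above 4 would pass
    7. *)
Lemma first_fill_unique y z : y \in D -> z \in F1 ++ x :: F2 -> 2 < v z -> D = [:: y].
Proof.
have [t2 u2] := pair_gt4; have un := under => yD zF z2.
have big d : d \in D -> 2 < v d by move=> dD; apply: lt_le_trans z2 _; exact: v_first.
case: D yD un big => [//|d [|e D']] yD un big; first by move: yD; rewrite inE => /eqP ->.
have := big d (mem_head _ _); have := big e (mem_behead (s := d :: e :: D') (mem_head _ _)).
have := worth_ge0 (h := v) (s := D') (fun z _ => v_ge0 z).
by move: un; rewrite !worth_cons => *; exfalso; lra.
Qed.

(** If a fill worth [2 + g] remains, a nonempty [D] is a single fill at least that good. The pair is
    then below [5 - g], and the clause with [tot - 2] pays for two fills. *)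
Lemma before_overshoot_scheme :
  (forall g, 0 < g < 1 / 3 -> (exists2 y, y \in F & 2 + g <= v y) ->
     scheme g n.+1 (rcons T t) (rcons M u) F) ->
  forall g, 0 < g < 1 / 3 -> (exists2 y, y \in F1 ++ F2 & 2 + g <= v y) -> scheme g n T M (F1 ++ F2).
Proof.
move=> sc g g03 [y yF y2]; have /andP [g0 g3] := g03.
apply: (scheme_step (sc g g03 _)); first by exists y => //; exact: mem_fill.
move=> w tot pw fw bw; have [wx1 _] := fw _ mem_last_fill.
case: (posnP (size D)) => [/size0nil ->|Dp]; first by rewrite worth_nil; lra.
have dD : nth 0%N D 0 \in D by rewrite mem_nth.
have yF' : y \in F1 ++ x :: F2 by move: yF; rewrite !mem_cat inE => /orP [->|->]; rewrite ?orbT.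
have y2' : 2 < v y by lra.
move: (nth 0%N D 0) dD => d dD.
have [wd1 _] := fw _ (mem_first_fill dD); have dy := v_first dD yF'.
have un := under; move: un; rewrite (first_fill_unique dD yF' y2') !worth_cons !worth_nil => un.
have : w t + w u <= tot - 2 by apply: bw; lra.
by lra.
Qed.

(** Cases on [D]: empty, without large fill, or with one. Passing 9 needs a large last fill: with
    [D] empty it leads to [after_overshoot], with a large good in [D] to [quartic]. *)
Lemma before_overshoot_step : (forall t' u', t' \in rcons T t -> u' \in rcons M u -> v t' + v u' < 7) ->
  before_overshoot n.+1 (rcons T t) (rcons M u) F ->
  before_overshoot n T M (F1 ++ F2) \/ after_overshoot n T M (F1 ++ F2).
Proof.
move=> p7 [[m [mv mF] st] sc].
have [t2 u2] := pair_gt4; have un := under; have P7 := p7 _ _ top_last mid_last.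
have x73 := goods_fill mem_last_fill; have x0 := v_ge0 x.
have mt : m t = v t by have [_] := mv t; apply.
have mu : m u = v u by have [_] := mv u; apply.
have sc' := before_overshoot_scheme sc.
have mF' : measure_ok m (F1 ++ F2).
  by split=> //; case: mF => [?|h]; [left | right=> y yF; apply: h; exact: mem_fill].
have up : calm m n T M (F1 ++ F2) \/ quartic m n T M (F1 ++ F2) -> before_overshoot n T M (F1 ++ F2).
  by move=> H; split=> //; exists m.
have spread : (forall y, y \in F -> 2 < v y \/ v y < 1 / 3) ->
    forall y, y \in F1 ++ F2 -> 2 < v y \/ v y < 1 / 3.
  by move=> h y yF; apply: h; exact: mem_fill.
have mx : v x <= 2 -> m x <= 2 /\ ((forall y, m y = v y) \/ v x < 1 / 3).
  have [/andP [_ m76] _] := mv x.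
  case: mF => [h x2|/(_ _ mem_last_fill) [h|h] x2].
  - by rewrite h; split=> //; left.
  - by lra.
  - by split; [lra | right].
have mx3 : v x < 1 / 3 -> m x <= 7 / 18 by have [/andP [_ m76] _] := mv x; lra.
case: (posnP (size D)) => [/size0nil D0|Dp].
  have WD : worth v D = 0 by rewrite D0 worth_nil.
  have mD : worth m D = 0 by rewrite D0 worth_nil.
  have nD : nlarge D = 0%N by rewrite D0.
  have [x2|x2] := ltrP 2 (v x).
    have mxx : m x = v x by have [_] := mv x; apply.
    have [over|fine] := ltrP 9 (v t + v u + v x).
      (* Passing 9 forces the pair above [9 - v x = 7 - g]. Skipped fills are at least [x], and
         fills after [x] do not complete the pair to 7, so they are below [g]. *)
      right; exists (v x - 2); have g03 : 0 < v x - 2 < 1 / 3 by lra.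
      split=> //.
      - have xx : exists2 y, y \in F & 2 + (v x - 2) <= v y by exists x; [exact: mem_last_fill | lra].
        apply: (scheme_step (sc _ g03 xx)) => w tot pw fw _.
        have [wx1 _] := fw _ mem_last_fill.
        by have -> : worth w D = 0 by [rewrite D0 worth_nil]; lra.
      - by move=> t' u' tT uM; have := v_top tT; have := v_mid uM; lra.
      move=> y; rewrite mem_cat => /orP [yF|yF]; [left|right].
        by have := v_skipped yF; lra.
      by have := after_under yF; lra.
    left; apply: up; case: st => [[h9 h]|[h q]].
      left; split; first by move: h9; rewrite worth_remove natrS_mul; lra.
      case: h => [h|h|h]; [apply: Or31 | apply: Or32 | apply: Or33].
      - by apply: (budget_step h); rewrite nD x2 /=; lra.
      - by move=> t' u' tT uM; apply: h; [exact: mem_tops | exact: mem_mids].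
      - by move=> y yF; apply: h; exact: mem_fill.
    right; split; last exact: spread.
    by apply: (budget_step h); rewrite nD x2 /=; lra.
  have x2F : (2 < v x) = false by apply/negbTE; rewrite -leNgt.
  have [m2 mc] := mx x2.
  left; apply: up; case: st => [[h9 h]|[h q]].
    left; split.
      by move: h9; rewrite worth_remove natrS_mul; case: mc => [mc|/mx3 mc]; rewrite ?mc; lra.
    case: h => [h|h|h].
    (* Tops and mids leave in increasing order of value, so once a pair reaches 5 all later pairs
       do. Otherwise the bag stays below 5 + 2 and fits [budget]. *)
    - have [P5|P5] := lerP 5 (v t + v u).
        apply: Or32 => t' u' tT uM; have := v_top tT; have := v_mid uM; lra.
      by apply: Or31; apply: (budget_step h); rewrite nD x2F /=; lra.
    - by apply: Or32 => t' u' tT uM; apply: h; [exact: mem_tops | exact: mem_mids].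
    - by apply: Or33 => y yF; apply: h; exact: mem_fill.
  right; split; last exact: spread.
  apply: (budget_step h); rewrite nD x2F /=.
  by case: (q _ mem_last_fill) => [|/mx3 ?]; lra.
have m76 s : worth m s <= 7 / 6 * worth v s.
  by rewrite /worth mulr_sumr; apply: ler_sum => y _; have [/andP [_ ?] _] := mv y.
have mclean s : (forall y, m y = v y) -> worth m s = worth v s.
  by move=> h; rewrite /worth; apply: eq_bigr => y _; rewrite h.
have wD0 : 0 <= worth v D by apply: worth_ge0 => y _; exact: v_ge0.
have xF : x \in F1 ++ x :: F2 by rewrite mem_cat mem_head orbT.
have [/hasP [d dD d2]|/hasPn Dsmall] := boolP (has (fun y => 2 < v y) D); last first.
  have nD : nlarge D = 0%N.
    by apply/eqP; rewrite /nlarge -leqn0 leqNgt -has_count; apply/hasPn.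
  have Fsmall y : y \in F -> v y <= 2.
    rewrite /F mem_cat => /orP [yD|yF]; first by rewrite leNgt Dsmall.
    have dD : nth 0%N D 0 \in D by rewrite mem_nth.
    by apply: le_trans (v_first dD yF) _; rewrite leNgt Dsmall.
  have x2 := Fsmall _ mem_last_fill.
  have x2F : (2 < v x) = false by apply/negbTE; rewrite -leNgt.
  have [m2 mc] := mx x2; have mD := m76 D.
  left; apply: up; case: st => [[h9 h]|[h q]].
    left; split; last by apply: Or33 => y yF; apply: Fsmall; exact: mem_fill.
    move: h9; rewrite worth_remove natrS_mul mt mu.
    by case: mc => [mc|/mx3 mc]; rewrite ?mc ?(mclean D mc); lra.
  right; split; last exact: spread.
  apply: (budget_step h); rewrite nD x2F mt mu /=.
  by case: (q _ mem_last_fill) => [|/mx3 ?]; lra.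
have wd : v d + worth v (rem d D) = worth v D by rewrite -worth_cons (worth_perm v (perm_to_rem dD)).
have md : m d + worth m (rem d D) = worth m D by rewrite -worth_cons (worth_perm m (perm_to_rem dD)).
have mdd : m d = v d by have [_] := mv d; apply.
have wr0 : 0 <= worth v (rem d D) by apply: worth_ge0 => y _; exact: v_ge0.
have noquiet : ~ (forall t' u', t' \in rcons T t -> u' \in rcons M u -> 5 <= v t' + v u').
  by move=> h; have := h _ _ top_last mid_last; lra.
have nosmall : ~ (forall y, y \in F -> v y <= 2).
  by move=> h; have := h _ (mem_first_fill dD); lra.
have [x2|x2] := ltrP 2 (v x).
  have mxx : m x = v x by have [_] := mv x; apply.
  have eD := first_fill_unique dD xF x2.
  have nD : nlarge D = 1%N by rewrite eD /nlarge /= d2.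
  have wD : worth v D = v d by rewrite eD worth_cons worth_nil addr0.
  have mD : worth m D = v d by rewrite eD worth_cons worth_nil addr0.
  have bud : budget m n.+1 (rcons T t) (rcons M u) F -> budget m n T M (F1 ++ F2).
    by move=> h; apply: (budget_step h); rewrite nD x2 mt mu mD mxx /=; lra.
  left; apply: up; case: st => [[h9 h]|[h q]]; last by right; split; [exact: bud | exact: spread].
  case: h => [h|/noquiet //|/nosmall //].
  (* Four large goods above 9: a fill after [x] is below [7 - (v t + v u + v d)], hence below
     [v x - 2 < 1/3]. *)
  have [over|fine] := ltrP 9 (v t + v u + v d + v x).
    right; split; first exact: bud.
    move=> y; rewrite mem_cat => /orP [yF|yF]; [left|right].
      by have := v_skipped yF; lra.
    by have := after_under yF; rewrite wD; lra.
  left; split; last by apply: Or31; exact: bud.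
  by move: h9; rewrite worth_remove natrS_mul mt mu mD mxx; lra.
have x2F : (2 < v x) = false by apply/negbTE; rewrite -leNgt.
have [m2 mc] := mx x2; have mD := m76 (rem d D).
have nD : nlarge D = 1%N.
  rewrite /nlarge (permP (perm_to_rem dD)) /= d2 add1n; congr S.
  apply/eqP; rewrite -leqn0 leqNgt -has_count; apply/hasPn => y yr.
  have := worth_mem_le (h := v) (fun z _ => v_ge0 z) yr => yw.
  by rewrite -leNgt; lra.
have m9 : m t + m u + worth m D + m x <= 9.
  rewrite -md mt mu mdd.
  by case: mc => [mc|/mx3 mc]; rewrite ?mc ?(mclean _ mc); lra.
have bud : budget m n.+1 (rcons T t) (rcons M u) F -> budget m n T M (F1 ++ F2).
  by move=> h; apply: (budget_step h); rewrite nD x2F /=; lra.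
left; apply: up; case: st => [[h9 h]|[h q]]; last by right; split; [exact: bud | exact: spread].
case: h => [h|/noquiet //|/nosmall //].
left; split; last by apply: Or31; exact: bud.
by move: h9; rewrite worth_remove natrS_mul; lra.
Qed.

End LargeStep.

Lemma agent_step : agent_inv n.+1 (rcons T t) (rcons M u) F -> agent_inv n T M (F1 ++ F2).
Proof.
move=> [p7 inv]; split; first by move=> t' u' tT uM; apply: p7; [exact: mem_tops | exact: mem_mids].
case: inv => [/linear_step|[[gT gM gF] inv]]; [by left | right; split].
  by split=> [y /mem_tops /gT|y /mem_mids /gM|y /mem_fill /gF].
by case: inv => [/(before_overshoot_step gT gM gF p7)|/after_overshoot_step]; [|right].
Qed.

End Step.

(** Such an agent values each remaining pair, and the last one together with all fills, below 7.
    This contradicts every invariant: [7 - k] is at most [tot], 7/6 of 7 is below 9 - 1/3, and in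
    the counting case all fills together weigh less than 1/2. *)
Lemma agent_no_fail n T M F t u : size T = n -> size M = n ->
  agent_inv n.+1 (rcons T t) (rcons M u) F -> v t + v u + worth v F < 7 -> False.
Proof.
move=> zT zM [p7 inv] fail.
have tT : t \in rcons T t by rewrite mem_rcons mem_head.
have uM : u \in rcons M u by rewrite mem_rcons mem_head.
have zTM : size T = size M by rewrite zT zM.
have TT y : y \in T -> y \in rcons T t by rewrite mem_rcons inE => ->; rewrite orbT.
have MM y : y \in M -> y \in rcons M u by rewrite mem_rcons inE => ->; rewrite orbT.
have n0 : 0 <= n%:R :> R by exact: ler0n.
have tot_v : worth v (rcons T t ++ rcons M u ++ F) <= n%:R * 7 + (v t + v u + worth v F).
  rewrite !worth_cat !worth_rcons -zT.
  have := @pairs_worth_le R v 7 T M zTM (fun t' u' h1 h2 => ltW (p7 _ _ (TT _ h1) (MM _ h2))).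
  by lra.
case: inv => [[w [k [f [tot [[wv wt] f0 Ff le_tot tw]]]]]|[[gT gM gF] [[[m [mv mF] st] _]|]]].
- have h1 : worth w T + worth w M <= (size T)%:R * (7 - k).
    apply: pairs_worth_le => // t' u' h1 h2.
    by have := wt _ (TT _ h1); have := wv u'; have := p7 _ _ (TT _ h1) (MM _ h2); lra.
  have h2 : worth w F <= worth v F by apply: worth_le => y _; exact: wv.
  have h3 := wt _ tT; have h4 := wv u.
  have h5 : n%:R * (7 - k) <= n%:R * tot by apply: ler_wpM2l => //; lra.
  by move: tw; rewrite !worth_cat !worth_rcons natrS_mul; rewrite zT in h1; lra.
- have tot_m : worth m (rcons T t ++ rcons M u ++ F) <= 7 / 6 * worth v (rcons T t ++ rcons M u ++ F).
    rewrite /worth mulr_sumr; apply: ler_sum => y _; by have [/andP [_ ?] _] := mv y.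
  have c0 : 0 <= (nlarge F)%:R :> R by exact: ler0n.
  by case: st => [[h _]|[h _]]; move: h; rewrite /budget natrS_mul -?[n.+1]addn1 ?natrD; lra.
move=> [g [/andP [g0 g3] [w [tot [tw pw fw bw]]] pg fg]].
have P7 := pg _ _ tT uM.
have wF : worth w F <= worth v F / (2 * g).
  rewrite /worth mulr_suml; apply: worth_le => y yF; have [_] := fw _ yF; apply.
  by have := worth_mem_le (h := v) (fun z _ => v_ge0 z) yF; lra.
have h1 : worth v F / (2 * g) < 1 / 2 by rewrite ltr_pdivrMr; lra.
have h2 : worth w T + worth w M <= (size T)%:R * (tot - 1).
  by apply: pairs_worth_le => // t' u' h3 h4; apply: pw; [exact: TT | exact: MM].
have h3 := pw _ _ tT uM.
by move: tw; rewrite !worth_cat !worth_rcons natrS_mul; rewrite zT mulrBr mulr1 in h2; lra.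
Qed.

End AgentInvariants.

Lemma last_satisfying (p : pred nat) (s : seq nat) : has p s ->
  exists s1 x s2, [/\ s = s1 ++ x :: s2, p x & ~~ has p s2].
Proof.
elim: s => [//|y s IH] /=; case: (boolP (has p s)) => [/IH [s1 [x [s2 [-> px no]]]] _|no].
  by exists (y :: s1), x, s2.
by rewrite orbF => py; exists [::], y, s.
Qed.

(** * From agent invariants to allocations *)

Section Allocation.

Variables (R : realFieldType) (I : finType) (v : I -> nat -> R).
Hypothesis v_ge0 : forall i x, 0 <= v i x.
Hypothesis v_anti : forall i x y, (x <= y)%N -> v i y <= v i x.

Definition satisfiable (J : {set I}) (s : seq nat) : Prop :=
  exists A : nat -> I, forall i, i \in J -> 7 <= \sum_(x <- s | A x == i) v i x.

Lemma satisfiable_give (J : {set I}) (s S s' : seq nat) (i : I) :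
  uniq s -> perm_eq s (S ++ s') -> i \in J -> 7 <= worth (v i) S ->
  satisfiable (J :\ i) s' -> satisfiable J s.
Proof.
move=> us ps iJ Si [A HA]; exists (fun x => if x \in S then i else A x) => j jJ.
have uS : uniq (S ++ s') by rewrite -(perm_uniq ps).
have disj x : x \in s' -> x \in S = false.
  move=> xs; apply/negbTE/negP => xS.
  by move: uS; rewrite cat_uniq => /and3P [_ /hasPn /(_ _ xs)]; rewrite xS.
have big0 (r : seq nat) (P : pred nat) : 0 <= \sum_(x <- r | P x) v j x by apply: sumr_ge0.
rewrite (perm_big _ ps) big_cat /=; have [eji|nji] := eqVneq j i.
  apply: le_trans Si _; rewrite -eji [X in _ <= X + _]big_seq_cond.
  rewrite [X in _ <= X + _](eq_bigl (fun x => x \in S)); last first.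
    by move=> x; case xS : (x \in S); rewrite ?andbF // eqxx.
  by rewrite -big_seq lerDl.
have /HA h : j \in J :\ i by rewrite !inE nji.
apply: le_trans h _; rewrite [X in _ <= _ + X]big_seq_cond [X in X <= _]big_seq_cond.
rewrite [X in _ <= _ + X](eq_bigl (fun x => (x \in s') && (A x == j))) ?lerDr //.
by move=> x; case xs : (x \in s'); rewrite //= disj.
Qed.

Lemma satisfiable0 (i0 : I) s : satisfiable set0 s.
Proof. by exists (fun _ => i0) => i; rewrite inE. Qed.

Lemma phaseB (i0 : I) n (J : {set I}) (T M F : seq nat) :
  #|J| = n -> size T = n -> size M = n -> sorted ltn (T ++ M ++ F) ->
  (forall i, i \in J -> agent_inv (v i) n T M F) -> satisfiable J (T ++ M ++ F).
Proof.
elim: n J T M F => [|n IH] J T M F cJ zT zM so inv.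
  by move/eqP: cJ; rewrite cards_eq0 => /eqP ->; exact: satisfiable0.
case/lastP: T zT so inv => [//|T t]; case/lastP: M zM => [//|M u].
rewrite !size_rcons => -[zM] [zT] so inv.
have tT : t \in rcons T t by rewrite mem_rcons mem_head.
have uM : u \in rcons M u by rewrite mem_rcons mem_head.
pose P r := [exists i in J, 7 <= v i t + v i u + worth (v i) (take r F)].
have exP : exists r, P r.
  exists (size F); rewrite /P take_size.
  have [//|/existsPn no] := boolP [exists i in J, 7 <= v i t + v i u + worth (v i) F].
  have [i iJ] : exists i, i \in J by apply/card_gt0P; rewrite cJ.
  exfalso; apply: (agent_no_fail (v_ge0 i) zT zM (inv i iJ)).
  by have := no i; rewrite iJ /= -ltNge.
case: (ex_minnP exP) => r Pr rmin.
have r0 : (0 < r)%N.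
  rewrite lt0n; apply/eqP => r0; case/existsP: Pr => i /andP [iJ].
  rewrite r0 take0 worth_nil addr0 leNgt; have [p7 _] := inv i iJ.
  by rewrite p7.
have rF : (r.-1 < size F)%N.
  rewrite ltnNge; apply/negP => le; suff : (r <= r.-1)%N by lia.
  apply: rmin; rewrite /P (take_oversize le); move: Pr; rewrite /P take_oversize //.
  by lia.
pose D := take r.-1 F.
(* Minimality of [r] keeps [D] below 7 for everyone. The fill at position [r.-1] would complete the
   bag, but the last completing one is taken, so that no fill after it completes the bag for
   anybody. *)
pose p x := [exists i in J, 7 <= v i t + v i u + worth (v i) D + v i x].
have hasp : has p (drop r.-1 F).
  apply/hasP; exists (nth 0%N F r.-1).
    have -> : nth 0%N F r.-1 = nth 0%N (drop r.-1 F) 0 by rewrite nth_drop addn0.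
    by apply: mem_nth; rewrite size_drop subn_gt0.
  case/existsP: Pr => i /andP [iJ]; rewrite -(prednK r0) (take_nth 0%N) // worth_rcons => h.
  by apply/existsP; exists i; rewrite iJ addrA in h *.
have [F1 [x [F2 [eF px no]]]] := last_satisfying hasp.
have FE : F = D ++ F1 ++ x :: F2 by rewrite -eF cat_take_drop.
case/existsP: px => i /andP [iJ hi].
have us : uniq (rcons T t ++ rcons M u ++ F).
  by apply: sorted_uniq so; [exact: ltn_trans | exact: ltnn].
apply: (@satisfiable_give J _ ([:: t; u] ++ D ++ [:: x]) (T ++ M ++ F1 ++ F2) i) => //.
- by apply/permP => a; rewrite FE -!cats1 !count_cat /=; clear; lia.
- by rewrite !worth_cat !worth_cons !worth_nil; lra.
have so' : sorted ltn (T ++ M ++ F1 ++ F2).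
  apply: (subseq_sorted ltn_trans _ so); rewrite FE.
  apply: cat_subseq; first exact: subseq_rcons.
  apply: cat_subseq; first exact: subseq_rcons.
  apply: subseq_trans (suffix_subseq D _).
  by apply: cat_subseq => //; exact: subseq_cons.
apply: IH => //; first by move: cJ; rewrite (cardsD1 i) iJ => -[].
move=> j; rewrite !inE => /andP [nji jJ].
have noD : ~~ P r.-1 by apply/negP => /rmin; clear -r0; lia.
have under : v j t + v j u + worth (v j) D < 7.
  by rewrite ltNge; apply/negP => h; case/negP: noD; apply/existsP; exists j; rewrite jJ.
apply: (@agent_step R (v j) (v_ge0 j) (v_anti j) n T M D F1 F2 t u x) => //.
- by rewrite -FE.
- move=> y yF; rewrite ltNge; apply/negP => h; move/hasPn: no => /(_ _ yF) /existsP; apply.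
  by exists j; rewrite jJ.
by rewrite -FE; exact: inv.
Qed.

End Allocation.

(** * Upper bounds for the counting weights *)

Section SchemeBounds.

Variable R : realFieldType.
Implicit Types x c g : R.

Lemma sch3_le1 x : x <= 4 -> sch3 x <= 1.
Proof. by move=> x4; rewrite /sch3; case: ifP => [|_]; [lra | rewrite ge_max; lra]. Qed.

Lemma sch3_le2 x : x <= 5 -> sch3 x <= 2.
Proof. by move=> x4; rewrite /sch3; case: ifP => [|_]; [lra | rewrite ge_max; lra]. Qed.

Lemma sch4_le_light c x : 8 / 3 < c < 3 -> x <= c -> sch4 c x <= 1 + (c - 8 / 3).
Proof.
move=> c3 xc; rewrite /sch4 xc; case: ifP => [|_]; first by lra.
by rewrite lerD2l ge_min lexx.
Qed.

Lemma sch4_le1 c x : 8 / 3 < c < 3 -> x <= 7 / 3 -> sch4 c x <= 1.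
Proof.
move=> c3 x7; rewrite /sch4; have -> : x <= c by lra.
case: ifP => [|_]; first by lra.
rewrite gerDl ge_min; apply/orP; right; rewrite ge_max lexx /=; lra.
Qed.

Lemma sch4_le_mid c x : 8 / 3 < c < 3 -> x <= 7 - c -> sch4 c x <= 2 - (c - 8 / 3).
Proof.
move=> c3 x7; have [xc|xc] := lerP x c; first by have := sch4_le_light c3 xc; lra.
by rewrite /sch4 (lt_geF xc) x7; case: ifP => ?; lra.
Qed.

Lemma sch4_le c x : 8 / 3 < c < 3 -> sch4 c x <= 2 + (c - 8 / 3).
Proof.
move=> c3; have [x7|x7] := lerP x (7 - c); first by have := sch4_le_mid c3 x7; lra.
by rewrite /sch4 (lt_geF x7); do !case: ifP => ?; lra.
Qed.

Lemma sch4s_le1 g x : 0 < g <= 1 / 3 -> x <= 3 - g -> sch4s g x <= 1.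
Proof. by move=> g3 xg; rewrite /sch4s xg; case: ifP => _ //; rewrite ge_min lexx. Qed.

Lemma sch4s_le2 g x : sch4s g x <= 2.
Proof.
rewrite /sch4s; case: ifP => _; last by case: ifP => _ //; lra.
by apply: (@le_trans _ _ 1); [rewrite ge_min lexx | lra].
Qed.

End SchemeBounds.

(** * Giving away top-mid pairs worth 7 *)

Section PhaseA.

Variables (R : realFieldType) (v : nat -> R).
Hypothesis v_ge0 : forall x, 0 <= v x.
Hypothesis v_anti : forall x y, (x <= y)%N -> v y <= v x.

Definition linear_startA n T M F : Prop :=
  exists w : nat -> R, exists k f tot : R,
  [/\ (forall x, w x <= v x) /\ (forall t, t \in T -> w t <= v t - k),
      0 <= f, forall x, x \in F -> v x <= f, 7 + f - k <= tot
    & n%:R * tot <= worth w (T ++ M ++ F) /\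
      (forall t u, t \in T -> u \in M -> w t + w u <= tot)].

(** All counting weights are kept at once: which one will serve depends on the best mid that
    survives the pairs and on the [g] of a later overshoot. *)
Definition large_startA n T M F : Prop :=
  [/\ large_goods v T M F,
      exists m, [/\ measure_ok v m F, n%:R * 9 <= worth m (T ++ M ++ F) & budget v m n T M F],
      n%:R * 3 <= worth (fun x => sch3 (v x)) (T ++ M ++ F),
      forall c, 8 / 3 < c < 3 -> n%:R * 4 <= worth (fun x => sch4 c (v x)) (T ++ M ++ F)
    & forall g, 0 < g <= 1 / 3 -> n%:R * 4 <= worth (fun x => sch4s g (v x)) (T ++ M ++ F)].

Definition startA n T M F : Prop := linear_startA n T M F \/ large_startA n T M F.

Lemma worth_rem2 (h : nat -> R) T M F t u : t \in T -> u \in M ->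
  worth h (T ++ M ++ F) = worth h (rem t T ++ rem u M ++ F) + (h t + h u).
Proof.
move=> tT uM; rewrite !worth_cat (worth_perm h (perm_to_rem tT)) (worth_perm h (perm_to_rem uM)).
by rewrite !worth_cons; ring.
Qed.

(** A pair costs at most one share of each measure: 5 + 7/2 is below 9 - 1/3, and the counting
    weights give 2 + 1, [(2 + (c - 8/3)) + (2 - (c - 8/3))] and 2 + 2. *)
Lemma startA_step n T M F t u : t \in T -> u \in M ->
  startA n.+1 T M F -> startA n (rem t T) (rem u M) F.
Proof.
move=> tT uM; have rT y : y \in rem t T -> y \in T by exact: mem_rem.
have rM y : y \in rem u M -> y \in M by exact: mem_rem.
case=> [[w [k [f [tot [[wv wt] f0 Ff le_tot [tw pw]]]]]]|[[gT gM gF] [m [[mv mF] m9 bud]] s3 s4 s4s]].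
  left; exists w, k, f, tot; split=> //; first by split=> // y /rT /wt.
  split; last by move=> t' u' /rT tT' /rM; exact: pw.
  by have := pw _ _ tT uM; move: tw; rewrite (worth_rem2 w F tT uM) natrS_mul; lra.
have /andP [t2 t5] := gT _ tT; have /andP [u2 u7] := gM _ uM.
have mt : m t = v t by have [_] := mv t; apply.
have mu : m u = v u by have [_] := mv u; apply.
right; split.
- by split=> [y /rT /gT|y /rM /gM|].
- exists m; split=> //; first by move: m9; rewrite (worth_rem2 m F tT uM) natrS_mul mt mu; lra.
  move: bud; rewrite /budget (worth_rem2 m F tT uM) natrS_mul -[n.+1]addn1 natrD mt mu.
  by move: (n%:R * 9) (worth m _) => A B ?; lra.
- move: s3; rewrite (worth_rem2 _ F tT uM) natrS_mul.
  by have := sch3_le2 (ltW t5); have : sch3 (v u) <= 1 by [apply: sch3_le1; lra]; lra.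
- move=> c c3; move: (s4 c c3); rewrite (worth_rem2 _ F tT uM) natrS_mul.
  have : sch4 c (v u) <= 2 - (c - 8 / 3) by apply: sch4_le_mid => //; lra.
  by have := sch4_le (v t) c3; lra.
move=> g g3; move: (s4s g g3); rewrite (worth_rem2 _ F tT uM) natrS_mul.
by have := sch4s_le2 g (v t); have := sch4s_le2 g (v u); lra.
Qed.

(** Now no pair reaches 7, so tops are below [7 - v u0] for the best mid [u0]. The scheme depends on
    [v u0]: [sch3] from 3 on, [sch4] with [c = v u0] between [3 - g] and 3, [sch4s] below. In the
    first two ranges every pair exceeds [5 - g], so the clause with [tot - 2] is vacuous. *)
Lemma startA_agent n T M F : (0 < size M)%N -> sorted ltn (T ++ M ++ F) ->
  (forall t u, t \in T -> u \in M -> v t + v u < 7) -> startA n T M F -> agent_inv v n T M F.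
Proof.
move=> M0 so p7 st; split=> //; case: st => [[w [k [f [tot [wvt f0 Ff le_tot [tw pw]]]]]]|]; first by left; exists w, k, f, tot.
move=> [goods [m [mok m9 bud]] s3 s4 s4s]; right; split=> //; left; split.
  by exists m => //; left; split=> //; exact: Or31.
have [gT gM gF] := goods; clear goods bud m9 mok.
move=> g /andP [g0 g3] _.
have [u0 u0M u0max] : exists2 u0, u0 \in M & forall u, u \in M -> v u <= v u0.
  case: M M0 so {p7 s3 s4 s4s gM} => [//|u0 M] _ so; exists u0 => [|u]; first exact: mem_head.
  rewrite inE => /orP [/eqP -> //|uM]; apply/v_anti/ltnW.
  have : sorted ltn ([:: u0] ++ M).
    by apply: (subseq_sorted ltn_trans _ so); apply: subseq_trans (suffix_subseq T _); exact: prefix_subseq.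
  by move/ltn_sorted_cat; apply; rewrite ?inE.
have topsge t : t \in T -> v u0 <= v t.
  by move=> tT; apply/v_anti/ltnW; apply: (ltn_sorted_cat so) => //; rewrite mem_cat u0M.
have v2g x : v x < g -> v x <= v x / (2 * g).
  by move=> xg; rewrite ler_pdivlMr; [have := v_ge0 x; nra | lra].
have /andP [u02 u07] := gM _ u0M.
have [c3|c3] := lerP 3 (v u0).
  exists (fun x => sch3 (v x)), 3; split=> //.
  - move=> t u tT uM; have := p7 _ _ tT u0M => t7.
    have : sch3 (v t) <= 1 by apply: sch3_le1; lra.
    have : sch3 (v u) <= 1 by apply: sch3_le1; have /andP [] := gM _ uM; lra.
    by lra.
  - move=> x xF; have x7 := gF _ xF; split; first by apply: sch3_le1; lra.
    by move=> xg; rewrite /sch3 ifT; [exact: v2g | lra].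
  by move=> t u tT uM tu; exfalso; have := topsge _ tT; have /andP [] := gM _ uM; lra.
have [cg|cg] := ltrP (3 - g) (v u0).
  have c83 : 8 / 3 < v u0 < 3 by lra.
  exists (fun x => sch4 (v u0) (v x)), 4; split=> //.
  - exact: s4.
  - move=> t u tT uM; have := p7 _ _ tT u0M => t7.
    have : sch4 (v u0) (v t) <= 2 - (v u0 - 8 / 3) by apply: sch4_le_mid => //; lra.
    have := sch4_le_light c83 (u0max _ uM).
    by lra.
  - move=> x xF; have x7 := gF _ xF; split; first by apply: sch4_le1 => //; lra.
    by move=> xg; rewrite /sch4 ifT; [exact: v2g | lra].
  by move=> t u tT uM tu; exfalso; have := topsge _ tT; have /andP [] := gM _ uM; lra.
have g13 : 0 < g <= 1 / 3 by lra.
have light u : u \in M -> sch4s g (v u) <= 1.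
  by move=> uM; apply: sch4s_le1 => //; have := u0max _ uM; lra.
exists (fun x => sch4s g (v x)), 4; split=> //.
- exact: s4s.
- by move=> t u tT uM; have := light _ uM; have := sch4s_le2 g (v t); lra.
- move=> x xF; have x7 := gF _ xF; split; first by apply: sch4s_le1 => //; lra.
  move=> xg; rewrite /sch4s ifT; last by lra.
  rewrite ge_min; apply/orP; right; have x0 := v_ge0 x.
  rewrite ler_pdivrMr; last by lra.
  have -> : v x / (2 * g) * (3 * g) = 3 / 2 * v x by field; lra.
  by lra.
move=> t u tT uM tu; have := light _ uM; have /andP [u2 _] := gM _ uM.
have : sch4s g (v t) <= 1 by apply: sch4s_le1 => //; lra.
by lra.
Qed.

End PhaseA.

Lemma phaseA (R : realFieldType) (I : finType) (v : I -> nat -> R) (i0 : I) n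
    (J : {set I}) (T M F : seq nat) :
  (forall i x, 0 <= v i x) -> (forall i x y, (x <= y)%N -> v i y <= v i x) ->
  #|J| = n -> size T = n -> size M = n -> sorted ltn (T ++ M ++ F) ->
  (forall i, i \in J -> startA (v i) n T M F) -> satisfiable v J (T ++ M ++ F).
Proof.
move=> v_ge0 v_anti; elim: n J T M => [|n IH] J T M cJ zT zM so st.
  by move/eqP: cJ; rewrite cards_eq0 => /eqP ->; exact: satisfiable0.
have us : uniq (T ++ M ++ F) by apply: sorted_uniq so; [exact: ltn_trans | exact: ltnn].
have [/existsP [i /andP [iJ /hasP [t tT /hasP [u uM tu]]]]|/existsPn no] :=
  boolP [exists i in J, has (fun t => has (fun u => 7 <= v i t + v i u) M) T].
  apply: (@satisfiable_give _ _ v v_ge0 J _ [:: t; u] (rem t T ++ rem u M ++ F) i) => //.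
  - apply/permP => a; rewrite !count_cat /= (permP (perm_to_rem tT)) (permP (perm_to_rem uM)) /=; lia.
  - by rewrite !worth_cons worth_nil addr0.
  apply: IH.
  - by move: cJ; rewrite (cardsD1 i) iJ => -[].
  - by rewrite size_rem // zT.
  - by rewrite size_rem // zM.
  - apply: (subseq_sorted ltn_trans _ so); apply: cat_subseq; first exact: rem_subseq.
    by apply: cat_subseq => //; exact: rem_subseq.
  - by move=> j; rewrite !inE => /andP [_ jJ]; apply: startA_step => //; exact: st.
apply: (phaseB v_ge0 v_anti i0 cJ zT zM so) => j jJ; apply: (@startA_agent _ (v j) (v_ge0 j) (v_anti j)) => //.
- by rewrite zM.
- move=> t u tT uM; rewrite ltNge; apply/negP => tu; move/negP: (no j); rewrite jJ /=; apply.
  by apply/hasP; exists t => //; apply/hasP; exists u.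
exact: st.
Qed.

(** * The irreducible case and the main induction *)

Section EffBounds.

Variable R : realFieldType.
Implicit Types q k x : R.

Lemma eff_le_shift q k x : q + k <= x -> eff q k x <= x - k.
Proof.
move=> h; rewrite /eff ge_min; apply/orP; right; rewrite ge_max; apply/andP; split; first by lra.
by rewrite lerD2r ge_min lexx.
Qed.

Lemma eff_le_low q k x : x <= q + k -> eff q k x <= q.
Proof.
move=> h; rewrite /eff ge_min; apply/orP; right; rewrite ge_max lexx /=.
by rewrite lerBlDr ge_min h.
Qed.

Lemma eff_le_top q k x : q + k <= 5 -> eff q k x <= 5 - k.
Proof.
move=> h; rewrite /eff ge_min; apply/orP; right; rewrite ge_max; apply/andP; split; first by lra.
by rewrite lerD2r ge_min lexx orbT.
Qed.

Lemma sch3_ge_min x : 0 <= x -> Num.min 1 x <= sch3 x.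
Proof.
move=> x0; rewrite /sch3; case: ifP => _; first by rewrite ge_min lexx orbT.
by rewrite ge_min le_max lexx.
Qed.

Lemma sch4_ge_min c x : 8 / 3 < c < 3 -> 0 <= x -> Num.min 1 x <= sch4 c x.
Proof.
move=> c3 x0; rewrite /sch4; case: ifP => _; first by rewrite ge_min lexx orbT.
rewrite ge_min; apply/orP; left; case: ifP => _; last by case: ifP => _; lra.
by rewrite lerDl le_min le_max lexx /= andbT; lra.
Qed.

End EffBounds.

(** * Starting conditions when no reduction applies *)

Section Start.

Variables (R : realFieldType) (v : nat -> R).
Hypothesis v_ge0 : forall x, 0 <= v x.
Hypothesis v_anti : forall x y, (x <= y)%N -> v y <= v x.

Lemma worth_weight (w : R -> R) b : worth (fun x => w (v x)) b = weight w (map v b).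
Proof. by rewrite /worth /weight big_map. Qed.

Lemma worth_mass b : worth v b = mass (map v b).
Proof. by rewrite /worth /mass big_map. Qed.

Lemma worth_large_small b :
  [/\ worth v b = mass [seq x <- map v b | 2 < x] +
                    mass (filter (predC (fun x : R => 2 < x)) (map v b)),
      worth (boost v) b = mass [seq x <- map v b | 2 < x] +
                            7 / 6 * mass (filter (predC (fun x : R => 2 < x)) (map v b))
    & worth (dust v) b = mass (filter (predC (fun x : R => 2 < x)) (map v b))].
Proof.
rewrite /worth /mass !big_filter !big_map !mulr_sumr; split.
- exact: bigID.
- rewrite (bigID (fun x => 2 < v x)) /=; congr (_ + _); apply: eq_bigr => x.
    by rewrite /boost => ->.
  by rewrite /boost => /negbTE ->.
rewrite (bigID (fun x => 2 < v x)) /= big1 ?add0r; last by move=> x; rewrite /dust => ->.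
by apply: eq_bigr => x /negbTE; rewrite /dust => ->.
Qed.

Variables (n : nat) (T M F : seq nat).
Hypothesis so : sorted ltn (T ++ M ++ F).
Hypothesis top7 : forall t, t \in T -> v t < 7.
Hypothesis mid72 : forall u, u \in M -> v u < 7 / 2.
Hypothesis fill73 : forall x, x \in F -> v x < 7 / 3.
Hypothesis topfill : forall t x, t \in T -> x \in F -> v t + v x < 7.
Hypothesis nlargeF : (nlarge v F <= n)%N.

(** With [f = q - 2] the requirement [7 + f - k <= tot] becomes an equality for the bin weight
    [5 + q - k]. *)
Lemma linear_start (q k : R) : 0 <= k -> q + k <= 7 / 2 -> q <= 7 / 2 ->
  (forall t, t \in T -> k = 0 \/ q + k <= v t) -> (forall u, u \in M -> v u <= q + k) ->
  2 <= q -> (forall x, x \in F -> v x <= q - 2) ->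
  n%:R * (5 + q - k) <= worth (fun x => eff q k (v x)) (T ++ M ++ F) ->
  linear_startA v n T M F.
Proof.
move=> k0 qk q7 tk uk q2 fq tw.
exists (fun x => eff q k (v x)), k, (q - 2), (5 + q - k); split=> //; try lra.
- split=> [x|t /tk [->|h]]; [exact: eff_le | by rewrite subr0; exact: eff_le | exact: eff_le_shift].
split=> // t u tT uM; have := eff_le_low (uk _ uM); have := @eff_le_top _ q k (v t); lra.
Qed.

(** A fill above 2 forces all tops below 5 through [topfill], which the counting weights need. If no
    fill exceeds 2, the linear weights apply. *)
Lemma structured_startA (t0 u0 : nat) : t0 \in T -> u0 \in M ->
  (forall t, t \in T -> v t <= v t0) -> (forall u, u \in M -> v u <= v u0) ->
  structured v (T ++ M ++ F) n -> startA v n T M F.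
Proof.
move=> t0T u0M t0max u0max st.
set s := T ++ M ++ F in st.
have sT t : t \in T -> t \in s by rewrite mem_cat => ->.
have sM u : u \in M -> u \in s by rewrite !mem_cat => ->; rewrite orbT.
have sF x : x \in F -> x \in s by rewrite !mem_cat => ->; rewrite !orbT.
have v0 := v_ge0.
have ge_mid t u : t \in T -> u \in M -> v u <= v t.
  by move=> tT uM; apply/v_anti/ltnW; apply: (ltn_sorted_cat so) => //; rewrite mem_cat uM.
have ge_fill y x : y \in T ++ M -> x \in F -> v x <= v y.
  by move=> yT xF; apply/v_anti/ltnW; move: so; rewrite catA => /ltn_sorted_cat; apply.
have maxs x : x \in s -> v x <= v t0.
  rewrite !mem_cat => /or3P [/t0max //|/(ge_mid _ _ t0T) //|xF].
  by apply: ge_fill => //; rewrite mem_cat t0T.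
have inbin f j x : x \in bin f s j -> x \in s by rewrite mem_filter => /andP [].
have [/hasP [x0 x0F x02]|/hasPn small] := boolP (has (fun x => 2 < v x) F).
  right.
  have t5 t : t \in T -> v t < 5 by move=> tT; have := topfill tT x0F; lra.
  have lt5 x : x \in s -> v x < 5 by move=> xs; apply: le_lt_trans (maxs _ xs) (t5 _ t0T).
  have gd : large_goods v T M F.
    split=> [t tT|u uM|//].
      by rewrite t5 // andbT; apply: lt_le_trans x02 (ge_fill _ _ _ x0F); rewrite mem_cat tT.
    by rewrite mid72 // andbT; apply: lt_le_trans x02 (ge_fill _ _ _ x0F); rewrite mem_cat uM orbT.
  have nl : 0 <= (n%:R - (nlarge v F)%:R) / 3 :> R.
    by rewrite divr_ge0 // subr_ge0 ler_nat.
  case: st => [[f cl]|[G [G1 G2 di] [f di_bin]]].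
    have vb f' j x : x \in map v (bin f' s j) -> 0 <= x < 5.
      by case/mapP => y /inbin ys ->; rewrite v0 lt5.
    have W (w : R -> R) c : (forall x, 0 <= x -> Num.min 1 x <= w x) ->
        (forall b, (forall x, x \in b -> 0 <= x < 5) -> 9 <= mass b -> c <= weight w b) ->
        n%:R * c <= worth (fun x => w (v x)) s.
      move=> w0 wb; apply: (@worth_bins _ _ _ f).
        by move=> x _; apply: le_trans (w0 _ (v0 x)); rewrite le_min ler01 v0.
      by move=> j jn; rewrite worth_weight; apply: wb; [exact: vb | rewrite -worth_mass; exact: cl].
    have v9 : n%:R * 9 <= worth v s by apply: (@worth_bins _ _ _ f) => // x _; exact: v0.
    split=> //.
    - exists v; split=> //; last by rewrite /budget; lra.
      by split; [move=> x; split=> //; have := v0 x; lra | left].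
    - by apply: W; [exact: sch3_ge_min | exact: sch3_bin].
    - by move=> c c3; apply: W => [x|b]; [exact: sch4_ge_min | exact: sch4_bin].
    - by move=> g g3; apply: W => [x|b]; [exact: sch4s_ge_min | exact: sch4s_bin].
  have vb f' j x : x \in map v (bin f' s j) -> 0 <= x < 5 /\ (2 < x \/ x < 1).
    by case/mapP => y /inbin ys ->; rewrite v0 lt5 //; split=> //; have [_ []] := di _ ys; [left|right; lra].
  have W (w : R -> R) c : c <= 4 -> (forall x, 0 <= x -> Num.min 1 x <= w x) ->
      (forall b, (forall x, x \in b -> 0 <= x < 5) -> 9 <= mass b -> c <= weight w b) ->
      n%:R * c <= worth (fun x => w (v x)) s.
    move=> c4 w0 wb; apply: (@worth_bins _ _ _ f).
      by move=> x _; apply: le_trans (w0 _ (v0 x)); rewrite le_min ler01 v0.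
    move=> j jn; rewrite worth_weight; have [] := di_bin j jn.
    have [h1 -> ->] := worth_large_small (bin f s j) => mb [v9|dG].
      by apply: wb => [x /vb []|] //; rewrite -worth_mass.
    apply: le_trans c4 _; apply: count_dirty_bin w0 (vb f j) mb _; lra.
  have m9 : n%:R * 9 <= worth (boost v) s.
    apply: (@worth_bins _ _ _ f) => [x _|j jn]; first exact: boost_ge0.
    by have [] := di_bin j jn.
  split=> //.
  - exists (boost v); split=> //; last by rewrite /budget; lra.
    split.
      by move=> x; rewrite /boost; split; [case: ifP => _; have := v0 x; lra | move=> ->].
    by right=> x xF; have [_ []] := di _ (sF _ xF); [left | right; lra].
  - by apply: W => //; [lra | exact: sch3_ge_min | exact: sch3_bin].
  - by move=> c c3; apply: W => [||b] //; [move=> x; exact: sch4_ge_min | exact: sch4_bin].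
  - by move=> g g3; apply: W => [||b] //; [move=> x; exact: sch4s_ge_min | exact: sch4s_bin].
left.
have small2 x : x \in F -> v x <= 2 by move=> xF; rewrite leNgt small.
have t07 := top7 t0T; have u072 := mid72 u0M; have u00 := v0 u0.
case: st => [[f cl]|[G [G1 G2 di] [f di_bin]]].
  have [tu9|tu9] := lerP (v t0 + v u0) 9.
    exists v, 0, 2, 9; split=> //; try lra.
      by split=> // t _; rewrite subr0.
    split; first by apply: (@worth_bins _ _ _ f) => // x _; exact: v0.
    by move=> t u tT uM; have := t0max _ tT; have := u0max _ uM; lra.
  (* Chosen so that [9 - q] is the best top, [q + k] the best mid, and [q - 2 = 7 - v t0] bounds the
     fills. *)
  apply: (@linear_start (9 - v t0) (v t0 + v u0 - 9)); try lra.
  - by move=> t tT; right; have := ge_mid _ _ tT u0M; lra.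
  - by move=> u uM; have := u0max _ uM; lra.
  - by move=> x xF; have := topfill t0T xF; lra.
  apply: (@worth_bins _ _ _ f) => [x _|j jn].
    apply: le_trans (eff_ge_min _ _ _); rewrite le_min v0 andbT; lra.
  rewrite worth_weight; apply: eff_bin; try lra.
    by move=> x /mapP [y /inbin ys ->]; rewrite v0 /=; have := maxs _ ys; lra.
  by rewrite -worth_mass; exact: cl.
pose k := Num.max 0 (v u0 - (9 - G)).
have [k0 kE] : 0 <= k /\ (k = 0 /\ v u0 <= 9 - G \/ k = v u0 - (9 - G)).
  by rewrite /k; case: (lerP 0 (v u0 - (9 - G))) => h; split=> //; [right|left; split=> //; lra].
clearbody k.
apply: (@linear_start (9 - G) k) => //; try lra.
- by move=> t tT; case: kE => [[-> _]|->]; [left | right; have := ge_mid _ _ tT u0M; lra].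
- by move=> u uM; have uu0 := u0max _ uM; case: kE => [[-> u0q]|->]; lra.
- by move=> x xF; have := small2 _ xF; have [_ []] := di _ (sF _ xF); lra.
apply: (@worth_bins _ _ _ f) => [x _|j jn].
  apply: le_trans (eff_ge_min _ _ _); rewrite le_min v0 andbT; lra.
rewrite worth_weight; have [] := di_bin j jn.
have [-> -> ->] := worth_large_small (bin f s j) => mb h.
apply: eff_dirty_bin mb h => //; try lra.
by move=> x /mapP [y /inbin ys ->]; rewrite v0 /=; have [? _] := di _ ys; lra.
Qed.

End Start.

Lemma sorted_nth_ltn (s : seq nat) i j : sorted ltn s -> (i < j)%N -> (j < size s)%N ->
  (nth 0%N s i < nth 0%N s j)%N.
Proof. by move=> so ij js; apply: (sorted_ltn_nth ltn_trans) => //; exact: ltn_trans js. Qed.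

Lemma sorted_nth_leq (s : seq nat) i j : sorted ltn s -> (i <= j)%N -> (j < size s)%N ->
  (nth 0%N s i <= nth 0%N s j)%N.
Proof.
by move=> so; rewrite leq_eqVlt => /orP [/eqP -> //|ij] js; exact: ltnW (sorted_nth_ltn so ij js).
Qed.

Lemma mem_drop_nth (s : seq nat) k y : y \in drop k s ->
  exists2 j, (k <= j < size s)%N & y = nth 0%N s j.
Proof.
move=> yd; have := yd; rewrite -index_mem size_drop => h.
exists (k + index y (drop k s))%N; last by rewrite -nth_drop nth_index.
by rewrite leq_addr -ltn_subRL.
Qed.

Section Window.

Variables (R : realFieldType) (v : nat -> R).
Hypothesis v_anti : forall x y, (x <= y)%N -> v y <= v x.

Lemma window_small (s : seq nat) p k y : sorted ltn s ->
  worth v (take k.+1 (drop p s)) < 7 -> y \in drop (p + k) s -> k.+1%:R * v y < 7.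
Proof.
move=> so w7 /mem_drop_nth [j /andP [pj js] yE]; apply: le_lt_trans w7.
have zE : size (take k.+1 (drop p s)) = k.+1 by rewrite size_take size_drop; case: ifP; lia.
have -> : k.+1%:R * v y = \sum_(0 <= i < k.+1) v y by rewrite sumr_const_nat subn0 mulr_natl.
rewrite /worth [X in _ <= X](big_nth 0%N) zE.
apply: ler_sum_nat => i /andP [_ ik]; apply: v_anti.
rewrite nth_take // nth_drop yE; apply: sorted_nth_leq => //; lia.
Qed.

End Window.

Section MainLoop.

Variables (R : realFieldType) (I : finType) (v : I -> nat -> R) (i0 : I).
Hypothesis v_ge0 : forall i x, 0 <= v i x.
Hypothesis v_anti : forall i x y, (x <= y)%N -> v i y <= v i x.

(** The size bound keeps every window, up to [k = 3], inside the list; it survives the induction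
    because a round removes at most 4 goods. *)
Lemma structured_satisfiable n (J : {set I}) s : #|J| = n -> sorted ltn s ->
  (4 * n + 1 <= size s)%N -> (forall i, i \in J -> structured (v i) s n) -> satisfiable v J s.
Proof.
elim: n J s => [|n IH] J s cJ so zs st.
  by move/eqP: cJ; rewrite cards_eq0 => /eqP ->; exact: satisfiable0.
have us : uniq s by apply: sorted_uniq so; [exact: ltn_trans | exact: ltnn].
have cJ' i : i \in J -> #|J :\ i| = n by move=> iJ; move: cJ; rewrite (cardsD1 i) iJ => -[].
have window k : (k <= 3)%N -> satisfiable v J s \/
    forall i, i \in J -> worth (v i) (take k.+1 (drop (k * n) s)) < 7.
  move=> k3; set s2 := take _ _.
  have [/existsP [i /andP [iJ hi]]|/existsPn no] := boolP [exists i in J, 7 <= worth (v i) s2]; last first.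
    by right=> i iJ; have := no i; rewrite iJ /= -ltNge.
  left; set s1 := take (k * n) s; set s3 := drop (k.+1 + k * n) s.
  have sE : s = s1 ++ s2 ++ s3 by rewrite /s3 -drop_drop cat_take_drop cat_take_drop.
  have z1 : size s1 = (k * n)%N by rewrite size_take; case: ifP; nia.
  have z2 : size s2 = k.+1 by rewrite size_take size_drop; case: ifP; nia.
  apply: (@satisfiable_give _ _ v v_ge0 J s s2 (s1 ++ s3) i) => //.
    by rewrite {1}sE perm_catCA.
  apply: IH => //; first exact: cJ'.
  - apply: (subseq_sorted ltn_trans _ so); rewrite sE; apply: cat_subseq => //.
    exact: suffix_subseq.
  - by move: zs; rewrite sE !size_cat z2; nia.
  move=> j; rewrite !inE => /andP [_ jJ].
  apply: (@structured_pigeonhole _ (v j) (v_ge0 j) (v_anti j) s1 s2 s3 n k) => //; rewrite -sE //.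
  exact: st.
have [//|w0] := window 0%N isT.
have [//|w1] := window 1%N isT.
have [//|w2] := window 2%N isT.
have [//|w3] := window 3%N isT.
have below k i y : i \in J -> (forall i, i \in J -> worth (v i) (take k.+1 (drop (k * n) s)) < 7) ->
    y \in drop (k * n + k) s -> k.+1%:R * v i y < 7.
  by move=> iJ w; apply: (window_small (v_anti i)) => //; exact: w.
case sE : s => [|g s0]; first by move: zs; rewrite sE /=; lia.
have dropE k : drop k.+1 s = drop k s0 by rewrite sE.
pose p y := [exists i in J, 7 <= v i g + v i y].
have [hp|/hasPn nop] := boolP (has p (drop (2 * n).+1 s0)).
  have [F1 [y [F2 [eF py nop]]]] := last_satisfying hp.
  case/existsP: py => i /andP [iJ hi].
  have yd : y \in drop (2 * n).+1 s0 by rewrite eF mem_cat mem_head orbT.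
  have ys : y \in s0 := mem_drop yd.
  have gs0 : g \notin s0 by move: us; rewrite sE /= => /andP [].
  have gy : g != y by apply: contraNneq gs0 => ->.
  set s' := [seq x <- g :: s0 | x \notin [:: g; y]].
  have ps : perm_eq s ([:: g; y] ++ s').
    rewrite -(perm_filterC [pred x | x \in [:: g; y]] s) perm_cat //; last first.
      by rewrite sE; apply/permP => a; congr (count a _); apply: eq_filter => x.
    apply: uniq_perm; [by rewrite filter_uniq | by rewrite /= inE gy |].
    move=> x; rewrite mem_filter /= sE !inE; case: eqVneq => //= _.
    by case: eqVneq => // ->.
  rewrite -sE; apply: (@satisfiable_give _ _ v v_ge0 J s [:: g; y] s' i) => //.
    by rewrite !worth_cons worth_nil; lra.
  apply: IH; first exact: cJ'.
  - by apply: (subseq_sorted ltn_trans _ so); rewrite sE; exact: filter_subseq.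
  - by move: zs; rewrite (perm_size ps) size_cat /= => zs'; clear -zs'; lia.
  move=> j; rewrite !inE => /andP [_ jJ].
  have := so; rewrite sE => so'.
  apply: (@structured_pair _ (v j) (v_ge0 j) (v_anti j)) => //.
  - have gs : g \in drop (0 * n + 0) s by rewrite mul0n drop0 sE mem_head.
    by have := below 0%N j g jJ w0 gs; rewrite mul1r.
  - have yd2 : y \in drop (2 * n + 2) s by rewrite addn2 dropE.
    by have := below 2%N j y jJ w2 yd2; lra.
  - move=> z zs0 yz; rewrite ltNge; apply/negP => h; case/negP: nop.
    apply/hasP; exists z; last by apply/existsP; exists j; rewrite jJ.
    have : z \in take (2 * n).+1 s0 ++ F1 ++ y :: F2 by rewrite -eF cat_take_drop.
    rewrite catA mem_cat inE => /orP [zL|/orP [/eqP zy|//]]; last by rewrite zy ltnn in yz.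
    have : sorted ltn ((take (2 * n).+1 s0 ++ F1) ++ y :: F2).
      by rewrite -catA -eF cat_take_drop; exact: path_sorted so'.
    by move/ltn_sorted_cat => /(_ z y zL (mem_head _ _)); rewrite ltnNge (ltnW yz).
  by rewrite -sE; exact: st.
rewrite -sE; pose T := take n.+1 s; pose M := take n.+1 (drop n.+1 s).
pose F := drop (n.+1 + n.+1) s.
have sTMF : s = T ++ M ++ F by rewrite /F -drop_drop !cat_take_drop.
have zT : size T = n.+1 by rewrite size_take; case: ifP; lia.
have zM : size M = n.+1 by rewrite size_take size_drop; case: ifP; lia.
have FE : F = drop (2 * n).+1 s0 by rewrite /F addSn -dropE; congr drop; lia.
rewrite sTMF; apply: (@phaseA _ _ v i0 n.+1) => //; first by rewrite -sTMF.
move=> i iJ; have sort_cat := so; rewrite sTMF in sort_cat.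
pose u0 := head 0%N M.
have u0M : u0 \in M by rewrite /u0; case: (M) zM => //= u M' _; rewrite mem_head.
have gT : g \in T by rewrite /T sE /= mem_head.
have gmax t : t \in T -> v i t <= v i g.
  move=> /mem_take; rewrite sE inE => ts; apply: v_anti.
  have /allP min := order_path_min ltn_trans (eq_ind _ (sorted ltn) so _ sE).
  by case/orP: ts => [/eqP -> //|/min]; exact: ltnW.
have F2 : F = drop (2 * n + 2) s by rewrite /F; congr drop; clear; lia.
have F3 : (n.+1 + (n.+1 + n.+1) = 3 * n + 3)%N by clear; lia.
apply: (@structured_startA _ (v i) (v_ge0 i) (v_anti i) _ _ _ _ _ _ _ _ _ _ g u0) => //.

- move=> t tT; have ts : t \in drop (0 * n + 0) s by rewrite drop0 (mem_take tT).
  by have := below 0%N i t iJ w0 ts; rewrite mul1r.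
- move=> u /mem_take uM; have us' : u \in drop (1 * n + 1) s by rewrite mul1n addn1.
  by have := below 1%N i u iJ w1 us'; lra.
- by move=> x; rewrite F2 => xF; have := below 2%N i x iJ w2 xF; lra.
- move=> t x tT; rewrite FE => /nop h; have := gmax t tT; rewrite ltNge => vt; apply/negP => h7.
  by case/negP: h; apply/existsP; exists i; rewrite iJ /=; lra.
(* By the window with [k = 3], fills after the first [n.+1] are below 7/4, so they are not large. *)
- rewrite -(cat_take_drop n.+1 F) /nlarge count_cat.
  have -> : count (fun x => 2 < v i x) (drop n.+1 F) = 0%N.
    apply/eqP; rewrite -leqn0 leqNgt -has_count; apply/hasPn => x.
    by rewrite drop_drop F3 => xF; have := below 3%N i x iJ w3 xF; rewrite -leNgt; lra.
  by rewrite addn0 (leq_trans (count_size _ _)) // size_take; case: ifP => // /negbT; rewrite -leqNgt.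
- move=> u uM; apply: v_anti; rewrite /u0; move: uM; case ME : (M) => [//|m M'] /=.
  have soM : sorted ltn M.
    apply: (subseq_sorted ltn_trans _ so); rewrite sTMF.
    by apply: subseq_trans (suffix_subseq _ _); exact: prefix_subseq.
  move: soM; rewrite ME inE => /= /(order_path_min ltn_trans)/allP min /orP [/eqP -> //|/min]; exact: ltnW.
- by rewrite -sTMF; exact: st.
Qed.

End MainLoop.

Lemma sum_nth_map (R : realFieldType) (T : Type) (e : seq T) (f : T -> nat) (h : T -> R) d j :
  \sum_(0 <= k < size e | nth d (map f e) k == j) nth 0 (map h e) k = \sum_(g <- e | f g == j) h g.
Proof.
case: e => [|g0 e]; first by rewrite !big_nil.
rewrite [RHS](big_nth g0) [LHS]big_nat_cond [RHS]big_nat_cond; apply: eq_big => k.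
  by apply: andb_id2l => kz; rewrite (nth_map g0).
by case/andP=> kz _; rewrite (nth_map g0).
Qed.

(** * Reduction to ordered instances *)

Section Ordering.

Variables (R : realFieldType) (M : finType).
Implicit Types h : M -> R.

Definition by_value h : seq M := sort (fun a b => h b <= h a) (enum M).
Definition ranked h (k : nat) : R := nth 0 (map h (by_value h)) k.

Lemma size_by_value h : size (by_value h) = #|M|.
Proof. by rewrite size_sort cardE. Qed.

Lemma ranked_default h k : (#|M| <= k)%N -> ranked h k = 0.
Proof. by move=> Mk; rewrite /ranked nth_default // size_map size_by_value. Qed.

Lemma ranked_sorted h : sorted >=%R (map h (by_value h)).
Proof. by rewrite sorted_map; apply: sort_sorted => a b; exact: le_total. Qed.

Lemma ranked_le h j k : (j <= k)%N -> (k < #|M|)%N -> ranked h k <= ranked h j.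
Proof.
move=> jk kM.
apply: (sorted_leq_nth ge_trans ge_refl 0 (ranked_sorted h)); rewrite ?inE ?size_map ?size_by_value //.
exact: leq_ltn_trans kM.
Qed.

Lemma ranked_ge0 h k : (forall g, 0 <= h g) -> 0 <= ranked h k.
Proof.
move=> h0; case: (ltnP k #|M|) => [kM|/ranked_default -> //].
have : ranked h k \in map h (by_value h) by apply: mem_nth; rewrite size_map size_by_value.
by case/mapP => g _ ->.
Qed.

Lemma ranked_anti h j k : (forall g, 0 <= h g) -> (j <= k)%N -> ranked h k <= ranked h j.
Proof.
move=> h0 jk; case: (ltnP k #|M|) => [|/ranked_default ->]; first exact: ranked_le.
exact: ranked_ge0.
Qed.

(** Among the best [#|D| + 1] goods one is missing from [D]. *)
Lemma ranked_pick h (D : {set M}) : (#|D| < #|M|)%N ->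
  exists2 g, g \notin D & ranked h #|D| <= h g.
Proof.
move=> DM; set l := take #|D|.+1 (by_value h).
have zl : size l = #|D|.+1 by rewrite size_takel // size_by_value.
have ul : uniq l by apply: take_uniq; rewrite sort_uniq enum_uniq.
have /subsetPn [g gl gD] : ~~ (l \subset D).
  by apply/negP => /subset_leq_card; rewrite (card_uniqP ul) zl ltnn.
exists g => //; have zg : (index g l <= #|D|)%N by rewrite -ltnS -zl index_mem.
have -> : h g = ranked h (index g l).
  rewrite /ranked (nth_map g) ?size_by_value; last exact: leq_ltn_trans DM.
  by rewrite -(nth_take g (n0 := #|D|.+1)) ?ltnS // nth_index.
exact: ranked_le.
Qed.

(** In round [k] the agent who owns rank [k] in the ordered instance takes a free good worth at
    least that rank to them; [ranked_pick] provides it. *)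
Lemma picking_sequence (I : finType) (v : I -> M -> R) (A : nat -> I) k : (k <= #|M|)%N ->
  exists (D : {set M}) (B : M -> I), #|D| = k /\
    forall i, \sum_(0 <= j < k | A j == i) ranked (v i) j <= \sum_(g in D | B g == i) v i g.
Proof.
elim: k => [_|k IH kM].
  exists set0, (fun=> A 0%N); split; first exact: cards0.
  by move=> i; rewrite big_geq // big_pred0 // => g; rewrite inE.
have [D [B [cD HB]]] := IH (ltnW kM).
have [g gD hg] : exists2 g, g \notin D & ranked (v (A k)) k <= v (A k) g.
  by rewrite -cD; apply: ranked_pick; rewrite cD.
exists (g |: D), (fun x => if x == g then A k else B x); split; first by rewrite cardsU1 gD cD.
move=> i; rewrite big_mkcond big_nat_recr //= -big_mkcond.
rewrite [X in _ <= X]big_mkcondr big_setU1 //= eqxx addrC.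
apply: lerD; first by case: eqVneq => [<-|].
apply: le_trans (HB i) _; rewrite big_mkcondr; apply: ler_sum => x xD.
by case: (eqVneq x g) xD => // ->; rewrite (negbTE gD).
Qed.

Lemma ranked_binned h n (P : {ffun M -> 'I_n.+1}) (K : nat) (c : R) :
  (#|M| <= K)%N -> (forall g, 0 <= h g) -> (forall j, c <= addval h (bundle P j)) ->
  binned (fun b => c <= worth (ranked h) b) (iota 0 K) n.+1.
Proof.
(* The default [n.+1] is no bin label, so padding positions lie in no bin. *)
move=> MK h0 hP; exists (fun k => nth n.+1 (map (fun g => P g : nat) (by_value h)) k) => j jn.
apply: le_trans (hP (Ordinal jn)) _; rewrite /worth /bin big_filter.
rewrite -(subnKC MK) iotaD big_cat /=.
have -> : addval h (bundle P (Ordinal jn)) = \sum_(g <- by_value h | (P g : nat) == j) h g.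
  rewrite (perm_big (enum M)) ?big_enum_cond; last by rewrite perm_sort.
  by apply: eq_bigl => g; rewrite inE.
rewrite -(@sum_nth_map _ _ _ _ _ n.+1) size_by_value /index_iota subn0 lerDl.
by apply: sumr_ge0 => k _; exact: ranked_ge0.
Qed.

End Ordering.

(** Strict positivity rules out that the maximum is only the neutral element 0. *)
Lemma MMS_attained (R : realFieldType) (M : finType) n (h : M -> R) : 0 < MMS n h ->
  exists P : {ffun M -> 'I_n.+1}, forall j, MMS n h <= addval h (bundle P j).
Proof.
move=> m0.
have [/existsP [P hP]|/existsPn no] := boolP [exists P : {ffun M -> 'I_n.+1},
    MMS n h <= \big[Num.min/addval h (bundle P ord0)]_(j < n.+1) addval h (bundle P j)].
  by exists P => j; apply: le_trans hP _; exact: bigmin_le_cond.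
suff : MMS n h < MMS n h by rewrite ltxx.
by rewrite {1}/MMS; apply: bigmax_lt => // P _; rewrite ltNge no.
Qed.

Theorem theorem3p1 (R : realFieldType) (M : finType) (n : nat)
    (v : 'I_n.+1 -> M -> R) (v_ge0 : forall i g, 0 <= v i g) :
  exists A : {ffun M -> 'I_n.+1},
    forall i : 'I_n.+1, (7 / 9) * MMS n (v i) <= addval (v i) (bundle A i).
Proof.
(* Agents with a nonpositive share accept any bundle, but the induction wants structure from
   everybody; they get a dummy valuation with [n.+1] goods worth 9. *)
pose u i k : R := if 0 < MMS n (v i) then 9 / MMS n (v i) * ranked (v i) k
                  else if (k < n.+1)%N then 9 else 0.
have u_ge0 i k : 0 <= u i k.
  rewrite /u; case: ifP => [m0|_]; last by case: ifP.
  by rewrite mulr_ge0 ?divr_ge0 ?ranked_ge0 // ltW.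
have u_anti i j k : (j <= k)%N -> u i k <= u i j.
  move=> jk; rewrite /u; case: ifP => [m0|_].
    by rewrite ler_wpM2l ?ranked_anti // divr_ge0 // ltW.
  by case: ifP => [kn|_]; [rewrite (leq_ltn_trans jk kn) | case: ifP].
pose K := (#|M| + (4 * n.+1 + 1))%N.
have [|||i _|A HA] := @structured_satisfiable R 'I_n.+1 u ord0 u_ge0 u_anti n.+1 setT (iota 0 K).
- by rewrite cardsT card_ord.
- exact: iota_ltn_sorted.
- by rewrite size_iota leq_addl.
- left; rewrite /u; case: (boolP (0 < MMS n (v i))) => [m0|_].
    have [P hP] := @MMS_attained R M n (v i) m0.
    have [|f Hf] := ranked_binned (K := K) _ (v_ge0 i) hP; first exact: leq_addr.
    exists f => j jn; rewrite /clean_bin /worth -mulr_sumr mulrAC ler_pdivlMr //.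
    by rewrite ler_pM2l //; exact: Hf.
  exists id => j jn; rewrite /clean_bin /worth /bin big_filter.
  rewrite (big_rem j) /= ?mem_iota; last by rewrite /K; clear -jn; lia.
  by rewrite eqxx jn lerDl sumr_ge0 // => k _; case: ifP.
have [D [B [_ HB]]] := picking_sequence v A (leqnn #|M|).
exists [ffun g => B g] => i; have {HB} := HB i.
have [m0|mle] := ltrP 0 (MMS n (v i)); last first.
  move=> _; apply: (@le_trans _ _ 0); first by lra.
  by apply: sumr_ge0.
move=> HB; apply: (@le_trans _ _ (\sum_(g in D | B g == i) v i g)); last first.
  rewrite /addval [X in _ <= X](bigID (mem D)) /= -[X in X <= _]addr0.
  apply: lerD; last exact: sumr_ge0.
  rewrite le_eqVlt (eq_bigl (fun g => (g \in bundle [ffun g => B g] i) && (g \in D))) ?eqxx // => g.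
  by rewrite inE ffunE andbC.
have pad : \sum_(k <- iota (0 + #|M|) (4 * n.+1 + 1) | A k == i) ranked (v i) k = 0.
  rewrite big_seq_cond big1 // => k.
  by rewrite mem_iota => /andP [/andP [Mk _] _]; exact: ranked_default.
apply: le_trans HB; have := HA i (in_setT i); rewrite /u m0 -mulr_sumr /K iotaD big_cat pad.
rewrite /= addr0 /index_iota subn0 mulrAC ler_pdivlMr //; lra.
Qed.
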